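(* Let $r\ge 1$, let $m_\bullet=(m_1,\ldots,m_r)$ be any sequence of integers with $m_i\ge 1$ for all $i$, and let $n$ be any integer with $n>M(m_\bullet)$. Then the Segre-determinantal locus $\operatorname{Seg}_{m_\bullet,n}\subset(\mathbb{P}^{m_\bullet})^{\times n}$ is an irreducible subvariety of codimension $n-M(m_\bullet)$.
   Context: All varieties are complex algebraic varieties. For a finite sequence of integers $m_\bullet=(m_1,\ldots,m_r)$ with all $m_i\ge1$, put $\mathbb{P}^{m_\bullet}:=\mathbb{P}^{m_1}\times\cdots\times\mathbb{P}^{m_r}$ and $M(m_\bullet):=(m_1+1)\cdots(m_r+1)-1$. Let $\sigma_{m_\bullet}:\mathbb{P}^{m_\bullet}\to\mathbb{P}^{M(m_\bullet)}$ be the Segre embedding, sending $([p_{i,0}:\cdots:p_{i,m_i}])_{1\le i\le r}$ to the point whose homogeneous coordinates are all products $p_{1,\alpha^{(1)}}\cdots p_{r,\alpha^{(r)}}$ with $0\le\alpha^{(j)}\le m_j$. For $n\ge1$, the Segre-determinantal locus $\operatorname{Seg}_{m_\bullet,n}\subset(\mathbb{P}^{m_\bullet})^{\times n}$ is the smallest closed subvariety containing all $(P_1,\ldots,P_n)\in(\mathbb{P}^{m_\bullet})^{\times n}$ such that the points $\sigma_{m_\bullet}(P_1),\ldots,\sigma_{m_\bullet}(P_n)$ lie on some common hyperplane of $\mathbb{P}^{M(m_\bullet)}$. *)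

(* Defs.v *)
From HB Require Import structures.
From mathcomp Require Import all_boot all_order all_algebra.
From mathcomp Require Import boolp classical_sets topology_structure.
From mathcomp Require Import mpoly.

Set Implicit Arguments.
Unset Strict Implicit.
Unset Printing Implicit Defensive.

Import GRing.Theory.
Local Open Scope ring_scope.
Local Open Scope classical_set_scope.

Section ProjectiveSpace.
Variables (K : fieldType) (m : nat).

Definition proj := {U : {vspace 'rV[K]_m.+1} | \dim U == 1%N}.

Lemma dim_pline (x : 'rV[K]_m.+1) : x != 0 -> \dim <[x]> == 1%N.
Proof. by rewrite dim_vline => ->. Qed.

(* The point [x_0 : ... : x_m]. *)
Definition pline (x : 'rV[K]_m.+1) (x0 : x != 0) : proj :=
  exist _ <[x]>%VS (dim_pline x0).

(* A choice of homogeneous coordinates. *)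
Definition hcoord (P : proj) : 'rV[K]_m.+1 := vpick (val P).

Lemma hcoord_neq0 (P : proj) : hcoord P != 0.
Proof. by rewrite vpick0 -dimv_eq0 (eqP (valP P)). Qed.

Lemma hcoordE (P : proj) : val P = <[hcoord P]>%VS.
Proof.
apply/esym/eqP; rewrite eqEdim (eqP (valP P)) dim_vline hcoord_neq0 /=.
by rewrite -memvE memv_pick.
Qed.

Lemma hcoord_uniq (P : proj) (x : 'rV[K]_m.+1) :
  val P = <[x]>%VS -> exists2 c : K, c != 0 & x = c *: hcoord P.
Proof.
move=> Px; have: x \in val P by rewrite Px memv_line.
rewrite hcoordE => /vlineP[c xE]; exists c => //; apply/eqP => c0.
have := valP P; rewrite /= Px dim_vline xE c0 scale0r eqxx.
by [].
Qed.

End ProjectiveSpace.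

(* The product of the P^(d i), i in I; (P^m)^n, where P^m itself is the product
   of the P^(m j), is the one indexed by pairs (i, j). *)
Definition multiproj (K : fieldType) (I : finType) (d : I -> nat) : Type :=
  forall i : I, proj K (d i).

HB.instance Definition _ (K : fieldType) (I : finType) (d : I -> nat) :=
  gen_eqMixin (multiproj K d).
HB.instance Definition _ (K : fieldType) (I : finType) (d : I -> nat) :=
  gen_choiceMixin (multiproj K d).

Section Zariski.
Variables (K : fieldType) (I : finType) (d : I -> nat).

(* The variable (i, a) stands for the a-th homogeneous coordinate of the i-th
   factor. *)
Definition pvar : finType := {i : I & 'I_(d i).+1}.

Definition flatten_coord (x : forall i, 'rV[K]_(d i).+1) (k : 'I_#|{: pvar}|) :
    K :=
  x (tag (enum_val k)) 0 (tagged (enum_val k)).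

Definition multihomog (e : I -> nat) (f : {mpoly K[#|{: pvar}|]}) : Prop :=
  forall u, u \in msupp f ->
    forall i, (\sum_(k | tag (enum_val k) == i) u k)%N = e i.

(* For multihomogeneous f, the vanishing does not depend on the choice of
   homogeneous coordinates: see [pvanishE]. *)
Definition pvanish (f : {mpoly K[#|{: pvar}|]}) (P : multiproj K d) : Prop :=
  f.@[flatten_coord (fun i => hcoord (P i))] = 0.

Definition zero_locus (F : set {mpoly K[#|{: pvar}|]}) : set (multiproj K d) :=
  [set P | forall f, F f -> pvanish f P].

Definition zariski_closed (Z : set (multiproj K d)) : Prop :=
  exists F, (forall f, F f -> exists e, multihomog e f) /\ Z = zero_locus F.

Lemma meval_multihomog e f (c : I -> K) (x : forall i, 'rV[K]_(d i).+1) :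
  multihomog e f ->
  f.@[flatten_coord (fun i => c i *: x i)]
    = (\prod_i c i ^+ e i) * f.@[flatten_coord x].
Proof.
move=> fe; rewrite !mevalE mulr_sumr big_seq [RHS]big_seq; apply: eq_bigr => u uf.
rewrite mulrCA; congr (_ * _); rewrite /flatten_coord.
under eq_bigr do rewrite mxE exprMn; rewrite big_split /=; congr (_ * _).
rewrite (partition_big (fun k : 'I_#|{: pvar}| => tag (enum_val k)) xpredT) //=.
apply: eq_bigr => i _; rewrite -(fe _ uf i) expr_sum.
by apply: eq_bigr => k /eqP ->.
Qed.

Lemma pvanishE e f (P : multiproj K d) (x : forall i, 'rV[K]_(d i).+1) :
  multihomog e f -> (forall i, val (P i) = <[x i]>%VS) ->
  pvanish f P <-> f.@[flatten_coord x] = 0.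
Proof.
move=> fe Px.
have /choice[c cP] i : exists c : K, c != 0 /\ x i = c *: hcoord (P i).
  by have [c] := hcoord_uniq (Px i); exists c.
have -> : x = (fun i => c i *: hcoord (P i)).
  by apply: functional_extensionality_dep => i; case: (cP i).
rewrite (meval_multihomog _ _ fe) /pvanish; split=> [->|/eqP]; first exact: mulr0.
rewrite mulf_eq0 => /orP[/prodf_eq0[i _]|/eqP //].
by rewrite expf_eq0 (negPf (cP i).1) andbF.
Qed.

Lemma multihomogM e1 e2 f g : multihomog e1 f -> multihomog e2 g ->
  multihomog (fun i => (e1 i + e2 i)%N) (f * g).
Proof.
move=> fe ge u /msuppM_le/allpairsP[[u1 u2] /= [uf ug ->]] i.
under eq_bigr do rewrite mnmDE.
by rewrite big_split /= (fe _ uf) (ge _ ug).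
Qed.

Let zopen : set_system (multiproj K d) := [set A | zariski_closed (~` A)].

Let zopenT : zopen setT.
Proof.
exists [set 1]; split=> [f ->|].
  exists (fun=> 0%N) => u; rewrite msupp1 inE => /eqP -> i.
  by rewrite big1 // => k _; rewrite mnm0E.
rewrite setCT; apply/esym/seteqP; split=> // P /(_ 1 erefl) /eqP.
by rewrite /pvanish meval1 oner_eq0.
Qed.

Let zopenI : setI_closed zopen.
Proof.
move=> A B [F [hF AF]] [G [hG BG]].
exists [set h | exists f g, [/\ F f, G g & h = f * g]]; split.
  move=> _ [f [g [/hF[e1 fe] /hG[e2 ge] ->]]].
  by exists (fun i => (e1 i + e2 i)%N); exact: multihomogM.
rewrite setCI AF BG; apply/seteqP; split=> P.
  by move=> [FP|GP] _ [f [g [Ff Gg ->]]];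
    rewrite /pvanish mevalM ?(FP f Ff) ?(GP g Gg) ?mul0r ?mulr0.
move=> FGP; have [FP|] := pselect (zero_locus F P); first by left.
move=> /existsNP[f /not_implyP[Ff fP]]; right=> g Gg.
have /eqP := FGP (f * g) (ex_intro _ f (ex_intro _ g (And3 Ff Gg erefl))).
by rewrite mevalM mulf_eq0 => /orP[/eqP //|/eqP].
Qed.

Let zopen_bigU (J : Type) (A : J -> set (multiproj K d)) :
  (forall j, zopen (A j)) -> zopen (\bigcup_j A j).
Proof.
move=> /choice[F FP]; exists (\bigcup_j F j); split.
  by move=> f [j _ Fjf]; exact: (FP j).1.
rewrite setC_bigcup; apply/seteqP; split=> P.
  by move=> AP f [j _ Fjf]; have := AP j Logic.I; rewrite (FP j).2; apply.
by move=> FjP j _; rewrite (FP j).2 => f Fjf; apply: FjP; exists j.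
Qed.

HB.instance Definition _ :=
  isOpenTopological.Build (multiproj K d) zopenT zopenI zopen_bigU.

Lemma closed_zariski (Z : set (multiproj K d)) : closed Z <-> zariski_closed Z.
Proof. by rewrite -openC -[X in _ <-> zariski_closed X]setCK. Qed.

End Zariski.

Section Codimension.
Variable T : topologicalType.

Definition irreducible (Z : set T) : Prop :=
  Z !=set0 /\
  forall A B, closed A -> closed B -> Z `<=` A `|` B -> Z `<=` A \/ Z `<=` B.

Definition irreducible_chain (Z : set T) (c : nat) (F : nat -> set T) : Prop :=
  [/\ F 0%N = Z,
      forall i, (i <= c)%N -> closed (F i) /\ irreducible (F i)
    & forall i, (i < c)%N -> F i `<` F i.+1].

(* For Z closed and irreducible: the supremum of the lengths of the chains
   Z = F 0 < F 1 < ... < F k of irreducible closed subsets is c. *)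
Definition has_codim (Z : set T) (c : nat) : Prop :=
  (exists F, irreducible_chain Z c F) /\
  (forall k F, irreducible_chain Z k F -> (k <= c)%N).

End Codimension.

Section Segre.
Variables (K : fieldType) (r : nat) (m : 'I_r -> nat).

Definition segre_dim : nat := (\prod_j (m j).+1).-1.

Definition multi_index : finType := {dffun forall j : 'I_r, 'I_(m j).+1}.

Lemma card_multi_index : segre_dim.+1 = #|{: multi_index}|.
Proof.
rewrite /segre_dim prednK ?prodn_gt0 //.
rewrite card_dep_ffun foldrE big_image /=.
by apply: eq_bigr => j _; rewrite card_ord.
Qed.

Definition nth_multi_index (k : 'I_segre_dim.+1) : multi_index :=
  enum_val (cast_ord card_multi_index k).

Definition segre_vec (x : forall j, 'rV[K]_(m j).+1) : 'rV[K]_segre_dim.+1 :=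
  \row_k \prod_j x j 0 (nth_multi_index k j).

Lemma segre_vec_neq0 (x : forall j, 'rV[K]_(m j).+1) :
  (forall j, x j != 0) -> segre_vec x != 0.
Proof.
move=> x0; have aP j : {a | x j 0 a != 0} by apply/cid/rV0Pn.
apply/rV0Pn.
exists (cast_ord (esym card_multi_index)
  (enum_rank (finfun (fun j => sval (aP j)) : multi_index))).
rewrite mxE; apply/prodf_neq0 => j _.
by rewrite /nth_multi_index cast_ordKV enum_rankK ffunE; exact: svalP (aP j).
Qed.

Definition segre (P : multiproj K m) : proj K segre_dim :=
  pline (segre_vec_neq0 (fun j => hcoord_neq0 (P j))).

Lemma segreE (P : multiproj K m) (x : forall j, 'rV[K]_(m j).+1) :
  (forall j, val (P j) = <[x j]>%VS) -> val (segre P) = <[segre_vec x]>%VS.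
Proof.
move=> Px.
have /choice[c cP] j : exists c : K, c != 0 /\ x j = c *: hcoord (P j).
  by have [c] := hcoord_uniq (Px j); exists c.
have -> : segre_vec x
    = (\prod_j c j) *: segre_vec (fun j => hcoord (P j)).
  apply/rowP => k; rewrite !mxE -big_split /=; apply: eq_bigr => j _.
  by rewrite (cP j).2 mxE.
have c0 : \prod_j c j != 0 by apply/prodf_neq0 => j _; exact: (cP j).1.
apply/vspaceP => v; apply/vlineP/vlineP => -[b ->].
  by exists (b / \prod_j c j); rewrite scalerA divfK.
by exists (b * \prod_j c j); rewrite scalerA.
Qed.

Definition on_hyperplane (M : nat) (S : set (proj K M)) : Prop :=
  exists2 H : {vspace 'rV[K]_M.+1}, \dim H = M
    & forall Q, S Q -> (val Q <= H)%VS.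

Definition multiproj_pow (n : nat) : topologicalType :=
  multiproj K (fun ij : 'I_n * 'I_r => m ij.2).

Definition factor (n : nat) (P : multiproj_pow n) (i : 'I_n) : multiproj K m :=
  fun j => P (i, j).

Definition Seg (n : nat) : set (multiproj_pow n) :=
  smallest closed
    [set P | on_hyperplane [set segre (factor P i) | i in [set: 'I_n]]].

End Segre.

Arguments Seg : clear implicits.

(* Main.v *)
Require Import Defs.
From mathcomp Require Import all_boot all_order all_algebra.
From mathcomp Require Import boolp classical_sets reals topology_structure.
From mathcomp Require Import complex.
From mathcomp Require Import perm mpoly.

(* The locus consists of the tuples (P_1, ..., P_n) for which some nonzero multilinear form h
   vanishes at all the P_i; it is closed by the vanishing of maximal minors.  Call a tuple regular
   if at each P_i the form h has a nonzero partial derivative in the direction of every factor.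
   Two regular tuples are joined by a polynomial curve of regular tuples: take the lines between
   the forms and between the points, and push each point back onto the moving hypersurface by
   correcting one factor, in which h is linear.  So the regular tuples form an irreducible set.
   It is dense: with h fixed, a singular point of h = 0 moves along a curve inside h = 0 to a
   point where one partial derivative is nonzero, and from there the same correction leads to
   regular tuples.  The same argument applies when only the first q points are asked to lie on a
   hyperplane, and q = n, n - 1, ..., M gives a chain of length n - M.

   Conversely, along a strict chain of irreducible closed sets the number of algebraically
   independent functions grows by at least one at each step, and it is at most the number of
   affine coordinates of the ambient product.  On the locus, all affine coordinates but one for
   each of the points P_i, i > M, are independent: the first M points determine h, and the missing
   coordinate is the solution of a linear equation. *)

Set Implicit Arguments.
Unset Strict Implicit.
Unset Printing Implicit Defensive.

Import GRing.Theory.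

(** * Multivariate polynomials *)

Section MpolyAlgebra.
Local Open Scope ring_scope.
Variable K : fieldType.

Lemma widen_ord_lift n (i : 'I_n) : widen_ord (leqnSn n) i = lift ord_max i.
Proof. by apply: val_inj; rewrite /= /bump leqNgt ltn_ord. Qed.

Lemma meval_muni n (Q : {mpoly K[n.+1]}) (v : 'I_n.+1 -> K) :
  Q.@[v] = (map_poly (meval (fun i => v (widen_ord (leqnSn n) i))) (muni Q)).[v ord_max].
Proof.
rewrite muniE mevalE rmorph_sum horner_sum; apply: eq_bigr => u _.
rewrite /= map_polyZ /= map_polyXn hornerZ hornerXn mevalZ mevalX.
rewrite big_ord_recr /= mulrA; congr (_ * _ * _).
by apply: eq_bigr => i _; rewrite mnmE.
Qed.

Lemma muni_inj n : injective (@muni n K).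
Proof.
apply: raddf_inj => Q Q0; apply/mpolyP => u; rewrite mcoeff0.
pose r (w : 'X_{1..n.+1}) := [multinom w (widen_ord (leqnSn n) i) | i < n].
suff <- : (muni Q)`_(u ord_max)@_(r u) = Q@_u by rewrite Q0 coef0 mcoeff0.
rewrite muniE coef_sum raddf_sum /= [in RHS](mpolyE Q) raddf_sum /=.
apply: eq_bigr => w _; rewrite coefZ coefXn -scalerAl mcoeffZ mcoeffZ mcoeffX.
have -> : (w == u) = (r w == r u) && (u ord_max == w ord_max).
  apply/eqP/andP => [-> //|[/eqP/mnmP ruw /eqP uw]]; apply/mnmP => i.
  have [j ->|->] := unliftP ord_max i; last by rewrite uw.
  by have := ruw j; rewrite !mnmE !widen_ord_lift.
rewrite (eq_sym (u ord_max)); case: eqP => _; last by rewrite mulr0 mcoeff0 andbF mulr0.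
by rewrite mulr1 mcoeffX andbT.
Qed.

Hypothesis infK : forall p : {poly K}, p != 0 -> exists t, p.[t] != 0.

(** By induction on the number of variables: a nonzero coefficient of [Q], seen as a polynomial in
    the last variable, is nonzero at some point, and then the last variable is chosen. *)
Lemma mpoly_neq0_meval n (Q : {mpoly K[n]}) : Q != 0 -> exists v, Q.@[v] != 0.
Proof.
elim: n Q => [|n IH] Q Q0.
  exists (fun=> 0); apply: contra_neq Q0 => Qv; apply/mpolyP => u.
  rewrite mcoeff0 -{}Qv [in LHS](mpolyE Q) raddf_sum mevalE; apply: eq_bigr => w _.
  rewrite /= mcoeffZ mcoeffX big_ord0; congr (_ * _).
  by rewrite (_ : w == u) //; apply/eqP/mnmP => -[].
have q0 : muni Q != 0 by rewrite (raddf_eq0 _ (@muni_inj n)).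
have [k /IH[v vk]] : exists k, (muni Q)`_k != 0.
  by exists (size (muni Q)).-1; rewrite -/(lead_coef _) lead_coef_eq0.
have /infK[t tP] : map_poly (meval v) (muni Q) != 0.
  by apply: contra_neq vk => /(congr1 (fun p : {poly K} => p`_k)); rewrite coef_map coef0.
exists (fun i => if unlift ord_max i is Some j then v j else t).
rewrite meval_muni unlift_none; congr (_ != 0): tP; congr (_.[t]).
apply: eq_map_poly => p; apply: meval_eq => i.
by rewrite widen_ord_lift liftK.
Qed.

End MpolyAlgebra.

(** * Algebraic dependence of more polynomials than variables *)

Section Dependence.
Local Open Scope ring_scope.
Variable K : fieldType.

Let mdeg_le N (p : {mpoly K[N]}) D := forall u, u \in msupp p -> (mdeg u <= D)%N.

Let mdeg_leM N (p q : {mpoly K[N]}) D E :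
  mdeg_le p D -> mdeg_le q E -> mdeg_le (p * q) (D + E).
Proof.
move=> pD qE u /msuppM_le/allpairsP[[u1 u2] /= [/pD uD /qE uE ->]].
by rewrite mdegD leq_add.
Qed.

Let mdeg_le1 N : mdeg_le (1 : {mpoly K[N]}) 0.
Proof. by move=> u; rewrite msupp1 inE => /eqP ->; rewrite mdeg0. Qed.

Let mdeg_leX N (p : {mpoly K[N]}) D k : mdeg_le p D -> mdeg_le (p ^+ k) (k * D).
Proof.
move=> pD; elim: k => [|k IH]; first by rewrite expr0 mul0n; exact: mdeg_le1.
by rewrite exprS mulSn; exact: mdeg_leM.
Qed.

Lemma mpoly_dependent e N (G : e.-tuple {mpoly K[N]}) : (N < e)%N ->
  exists2 Q : {mpoly K[e]}, Q != 0 & Q \mPo G = 0.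
Proof.
move=> Ne; pose D := (\max_(i < e) msize (tnth G i))%N.
have GD i : mdeg_le (tnth G i) D.
  move=> u /msize_mdeg_lt/ltnW/leq_trans; apply.
  exact: (leq_bigmax (F := fun i => msize (tnth G i))).
(* The s ^ e monomials with all exponents below s are mapped to a space of dimension B ^ N, and
   s ^ e > B ^ N as soon as s > C ^ N. *)
pose C := (e * D).+1; pose s := (C ^ N).+1; pose B := (s * C)%N.
pose FU : finType := {ffun 'I_e -> 'I_s}; pose FV : finType := {ffun 'I_N -> 'I_B}.
pose mU (f : FU) : 'X_{1..e} := [multinom (f i : nat) | i < e].
pose mV (f : FV) : 'X_{1..N} := [multinom (f i : nat) | i < N].
pose Mx : 'M[K]_(#|FU|, #|FV|) :=
  \matrix_(a, b) ('X_[mU (enum_val a)] \mPo G)@_(mV (enum_val b)).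
have ltFVU : (#|FV| < #|FU|)%N.
  rewrite !card_ffun !card_ord /B expnMn.
  apply: (@leq_trans (s ^ N * s)%N); last by rewrite -expnSr leq_pexp2l.
  by rewrite ltn_pmul2l // expn_gt0.
(* There are more rows than columns: a nonzero [c] in the left kernel combines the monomials into
   [Q], whose image has no term with all exponents below [B]. *)
have /rowV0Pn[c /sub_kermxP cM c0] : kermx Mx != 0.
  rewrite -mxrank_eq0 mxrank_ker subn_eq0 -ltnNge.
  exact: leq_ltn_trans (rank_leq_col _) ltFVU.
pose Q : {mpoly K[e]} := \sum_a c 0 a *: 'X_[mU (enum_val a)].
have mUinj a b : (mU (enum_val a) == mU (enum_val b)) = (a == b).
  apply/eqP/eqP => [/mnmP E|-> //]; apply: enum_val_inj; apply/ffunP => i.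
  by apply: val_inj; have := E i; rewrite !mnmE.
exists Q.
  have /rV0Pn[a ca] := c0; apply: contra_neq ca => /(congr1 (mcoeff (mU (enum_val a)))).
  rewrite mcoeff0 raddf_sum (bigD1 a) //= big1 ?addr0 => [|b ba].
    by rewrite mcoeffZ mcoeffX eqxx mulr1.
  by rewrite mcoeffZ mcoeffX mUinj (negPf ba) mulr0.
apply/mpolyP => u; rewrite mcoeff0 /Q (raddf_sum (comp_mpoly G)) raddf_sum /=.
(* Exponents of [B] or more do not occur in the image, whose degree is at most [s * (e * D) < B]. *)
have [i Bu|uB'] := pickP (fun i => B <= u i)%N.
  apply: big1 => a _; rewrite comp_mpolyZ mcoeffZ comp_mpolyX memN_msupp_eq0 ?mulr0 //.
  have: mdeg_le (\prod_i tnth G i ^+ mU (enum_val a) i)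
      (\sum_(i < e) mU (enum_val a) i * D).
    by elim/big_ind2: _ => // [x x' y y'|j _]; [exact: mdeg_leM|exact: mdeg_leX].
  move=> /(_ u) uP; apply/negP => /uP; apply/negP; rewrite -ltnNge.
  have: (u i <= mdeg u)%N by rewrite mdegE (bigD1 i) //= leq_addr.
  apply: leq_trans; apply: leq_trans Bu.
  have: (\sum_(i < e) mU (enum_val a) i * D <= \sum_(i < e) s * D)%N.
    by apply: leq_sum => j _; rewrite mnmE leq_mul2r ltnW ?orbT.
  rewrite sum_nat_const card_ord mulnCA => /leq_ltn_trans; apply.
  by rewrite /B ltn_pmul2l.
have uB i : (u i < B)%N by rewrite ltnNge uB'.
have -> : u = mV [ffun i => Ordinal (uB i)].
  by apply/mnmP => i; rewrite mnmE ffunE.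
have := congr1 (fun M : 'rV_ _ => M 0 (enum_rank [ffun i => Ordinal (uB i)])) cM.
rewrite !mxE => {2}<-; apply: eq_bigr => a _.
by rewrite comp_mpolyZ mcoeffZ !mxE enum_rankK.
Qed.

End Dependence.

(** * Polynomial curves in products of projective spaces *)

Section Multihomogeneous.
Local Open Scope ring_scope.
Variables (K : fieldType) (I : finType) (d : I -> nat).
Notation pol := {mpoly K[#|{: pvar d}|]}.

Lemma eq_multihomog e e' (f : pol) : multihomog e f -> e =1 e' -> multihomog e' f.
Proof. by move=> fe ee' u uf i; rewrite -ee' fe. Qed.

Lemma multihomogD e (f g : pol) : multihomog e f -> multihomog e g -> multihomog e (f + g).
Proof. by move=> fe ge u /msuppD_le; rewrite mem_cat => /orP[/fe|/ge]. Qed.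

Lemma multihomog_sum (J : Type) (s : seq J) (P : pred J) (F : J -> pol) e :
  (forall j, P j -> multihomog e (F j)) -> multihomog e (\sum_(j <- s | P j) F j).
Proof.
move=> Fe; apply: big_ind => // [u|f g]; first by rewrite msupp0.
exact: multihomogD.
Qed.

Lemma multihomogC c : multihomog (fun=> 0%N) (c%:MP : pol).
Proof.
move=> u; rewrite msuppC; case: ifP => // _; rewrite inE => /eqP -> i.
by rewrite big1 // => k _; rewrite mnm0E.
Qed.

Lemma multihomogZ c e (f : pol) : multihomog e f -> multihomog e (c *: f).
Proof. by move=> fe u /msuppZ_le/fe. Qed.

Lemma multihomog_prod (J : Type) (s : seq J) (F : J -> pol) (e : J -> I -> nat) :
  (forall j, multihomog (e j) (F j)) ->
  multihomog (fun i => \sum_(j <- s) e j i)%N (\prod_(j <- s) F j).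
Proof.
move=> Fe; elim: s => [|j s IH].
  rewrite big_nil -mpolyC1; apply: (eq_multihomog (@multihomogC 1)) => i.
  by rewrite big_nil.
rewrite big_cons; apply: (eq_multihomog (multihomogM (Fe j) IH)) => i.
by rewrite big_cons.
Qed.

Lemma multihomogX (v : pvar d) :
  multihomog (fun i => (tag v == i) : nat) ('X_(enum_rank v) : pol).
Proof.
move=> u; rewrite msuppX inE => /eqP -> i.
under eq_bigr do rewrite mnm1E.
rewrite big_mkcond (bigD1 (enum_rank v)) //= enum_rankK eqxx big1 ?addn0.
  by case: eqP.
by move=> k /negPf; rewrite eq_sym => ->; case: ifP.
Qed.

Lemma meval_pvar (v : pvar d) (x : forall i, 'rV[K]_(d i).+1) :
  ('X_(enum_rank v) : pol).@[flatten_coord x] = x (tag v) 0 (tagged v).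
Proof. by rewrite mevalXU /flatten_coord enum_rankK. Qed.

End Multihomogeneous.

(** * Polynomial functions of one parameter *)

Section PolynomialFunctions.
Local Open Scope ring_scope.
Variable K : fieldType.

Definition polyfun (g : K -> K) := exists p : {poly K}, forall t, g t = p.[t].

Lemma polyfun_cst c : polyfun (fun=> c).
Proof. by exists c%:P => t; rewrite hornerC. Qed.

Lemma polyfun_id : polyfun id.
Proof. by exists 'X => t; rewrite hornerX. Qed.

Lemma polyfunD f g : polyfun f -> polyfun g -> polyfun (fun t => f t + g t).
Proof. by move=> [p fp] [q gq]; exists (p + q) => t; rewrite hornerD fp gq. Qed.

Lemma polyfunM f g : polyfun f -> polyfun g -> polyfun (fun t => f t * g t).
Proof. by move=> [p fp] [q gq]; exists (p * q) => t; rewrite hornerM fp gq. Qed.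

Lemma polyfunN f : polyfun f -> polyfun (fun t => - f t).
Proof. by move=> [p fp]; exists (- p) => t; rewrite hornerN fp. Qed.

Lemma polyfunX f n : polyfun f -> polyfun (fun t => f t ^+ n).
Proof. by move=> [p fp]; exists (p ^+ n) => t; rewrite horner_exp fp. Qed.

Lemma polyfun_sum (J : Type) (s : seq J) (P : pred J) (F : J -> K -> K) :
  (forall j, P j -> polyfun (F j)) -> polyfun (fun t => \sum_(j <- s | P j) F j t).
Proof.
move=> FP; elim: s => [|j s IH].
  by under eq_fun do rewrite big_nil; exact: polyfun_cst.
case: (boolP (P j)) => Pj; last by under eq_fun do rewrite big_cons (negPf Pj).
by under eq_fun do rewrite big_cons Pj; exact: polyfunD (FP j Pj) IH.
Qed.

Lemma polyfun_prod (J : Type) (s : seq J) (P : pred J) (F : J -> K -> K) :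
  (forall j, P j -> polyfun (F j)) -> polyfun (fun t => \prod_(j <- s | P j) F j t).
Proof.
move=> FP; elim: s => [|j s IH].
  by under eq_fun do rewrite big_nil; exact: polyfun_cst.
case: (boolP (P j)) => Pj; last by under eq_fun do rewrite big_cons (negPf Pj).
by under eq_fun do rewrite big_cons Pj; exact: polyfunM (FP j Pj) IH.
Qed.

Lemma polyfun_meval n (Q : {mpoly K[n]}) (v : K -> 'I_n -> K) :
  (forall i, polyfun (v ^~ i)) -> polyfun (fun t => Q.@[v t]).
Proof.
move=> vp; under eq_fun do rewrite mevalE.
apply: polyfun_sum => u _; apply: polyfunM; first exact: polyfun_cst.
by apply: polyfun_prod => i _; apply: polyfunX.
Qed.

Lemma polyfun_det n (M : K -> 'M[K]_n) :
  (forall i j, polyfun (fun t => M t i j)) -> polyfun (fun t => \det (M t)).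
Proof.
move=> Mp; apply: polyfun_sum => s _; apply: polyfunM; first exact: polyfun_cst.
exact: polyfun_prod.
Qed.

Hypothesis infK : forall p : {poly K}, p != 0 -> exists t, p.[t] != 0.

Lemma polyfun_generic (J : finType) (g : J -> K -> K) :
  (forall j, polyfun (g j)) -> (forall j, exists t, g j t != 0) ->
  exists t, forall j, g j t != 0.
Proof.
move=> /choice[p gp] g0.
have /infK[t] : \prod_j p j != 0.
  apply/prodf_neq0 => j _; have [t] := g0 j; rewrite gp.
  by apply: contra_neq => ->; rewrite horner0.
rewrite horner_prod => /prodf_neq0 pt; exists t => j.
by rewrite gp; exact: pt.
Qed.

Lemma polyfun_generic2 (f g : K -> K) : polyfun f -> polyfun g ->
  (exists t, f t != 0) -> (exists t, g t != 0) -> exists t, f t != 0 /\ g t != 0.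
Proof.
move=> pf pg f0 g0; have [||t gt] := @polyfun_generic bool (fun b => if b then f else g).
- by case.
- by case.
- by exists t; split; [exact: (gt true)|exact: (gt false)].
Qed.

End PolynomialFunctions.

(** * Curves, closures and irreducibility *)

Section Curves.
Local Open Scope ring_scope.
Local Open Scope classical_set_scope.
Variables (K : fieldType) (I : finType) (d : I -> nat).
Hypothesis infK : forall p : {poly K}, p != 0 -> exists t, p.[t] != 0.
Notation family := (forall i, 'rV[K]_(d i).+1).

Definition represents (P : multiproj K d) (x : family) :=
  forall i, val (P i) = <[x i]>%VS.

Lemma represents_hcoord P : represents P (fun i => hcoord (P i)).
Proof. by move=> i; exact: hcoordE. Qed.

Lemma represents_neq0 P x : represents P x -> forall i, x i != 0.
Proof.
move=> Px i; have := valP (P i); rewrite /= Px dim_vline.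
by case: (x i != 0).
Qed.

Lemma represents_exists (x : family) : (forall i, x i != 0) ->
  exists P, represents P x.
Proof. by move=> x0; exists (fun i => pline (x0 i)). Qed.

Lemma vline_scale (V : vectType K) (c : K) (v : V) : c != 0 -> <[c *: v]>%VS = <[v]>%VS.
Proof.
move=> c0; apply/vspaceP => w; apply/vlineP/vlineP => -[k ->].
  by exists (k * c); rewrite scalerA.
by exists (k / c); rewrite scalerA divfK.
Qed.

Lemma represents_scale P x y : represents P x -> represents P y ->
  exists2 c : I -> K, forall i, c i != 0 & forall i, y i = c i *: x i.
Proof.
move=> Px Py; have /choice[c cP] i : exists c, c != 0 /\ y i = c *: x i.
  have [a a0 xE] := hcoord_uniq (Px i); have [b b0 yE] := hcoord_uniq (Py i).
  exists (b / a); split; first by rewrite mulf_neq0 ?invr_neq0.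
  by rewrite xE scalerA divfK.
by exists c => i; have [] := cP i.
Qed.

(** A curve of vectors, not of points: for special [t] some [c t i] may be zero, and then [c t]
    represents no point. *)
Definition curve (c : K -> family) := forall i a, polyfun (fun t => c t i 0 a).

Lemma polyfun_curve c (f : {mpoly K[#|{: pvar d}|]}) : curve c ->
  polyfun (fun t => f.@[flatten_coord (c t)]).
Proof. by move=> cc; apply: polyfun_meval => k; exact: cc. Qed.

(** In each factor, a coordinate that is nonzero at [t0] remains nonzero for generic [t]. *)
Lemma curve_generic c (g : K -> K) t0 P : curve c -> polyfun g ->
  (exists t, g t != 0) -> represents P (c t0) ->
  exists t, g t != 0 /\ exists R, represents R (c t).
Proof.
move=> cc pg g0 /represents_neq0 c0.
have ca i : {a | c t0 i 0 a != 0} by apply/cid/rV0Pn.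
have [||t [gt pt]] := polyfun_generic2 infK (g := fun t => \prod_i c t i 0 (sval (ca i))) pg _ g0.
- by apply: polyfun_prod => i _.
- by exists t0; apply/prodf_neq0 => i _; exact: svalP (ca i).
- exists t; split=> //; apply: represents_exists => i; apply/rV0Pn; exists (sval (ca i)).
  by move/prodf_neq0: pt; apply.
Qed.

(** An equation of a closed set containing [Z] that failed at [P] would fail at a generic point of
    the curve, which lies in [Z]. *)
Lemma curve_closure (Z : set (multiproj K d)) P c (g : K -> K) t0 :
  curve c -> polyfun g -> (exists t, g t != 0) -> represents P (c t0) ->
  (forall t R, g t != 0 -> represents R (c t) -> Z R) -> closure Z P.
Proof.
move=> cc pg g0 Pc cZ; rewrite closureE => C [/closed_zariski[F [hF ->]] ZC] f Ff.
have [e fe] := hF f Ff; apply/(pvanishE fe Pc)/eqP; apply/negPn/negP => ft0.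
have [t [ft gt]] := polyfun_generic2 infK (polyfun_curve f cc) pg (ex_intro _ t0 ft0) g0.
pose fg t := f.@[flatten_coord (c t)] * g t.
have [||s [/= fgs [R Rc]]] := curve_generic (g := fg) cc _ _ Pc.
- by apply: polyfunM => //; exact: polyfun_curve.
- by exists t; rewrite mulf_neq0.
- move: fgs; rewrite /fg mulf_eq0 => /norP[/eqP fs gs]; apply: fs.
  by apply/(pvanishE fe Rc); apply: ZC => //; exact: cZ gs Rc.
Qed.

(** If an equation of [A] fails at [P] and one of [B] fails at [Q], both fail at a generic point of
    the curve from [P] to [Q], and this point is in [Z]. *)
Lemma irreducible_curves (Z : set (multiproj K d)) : Z !=set0 ->
  (forall P Q, Z P -> Z Q -> exists c (g : K -> K) t0 t1,
    [/\ curve c, polyfun g, exists t, g t != 0, represents P (c t0) /\ represents Q (c t1)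
      & forall t R, g t != 0 -> represents R (c t) -> Z R]) ->
  irreducible Z.
Proof.
move=> Z0 Zc; split=> // A B /closed_zariski[F [hF ->]] /closed_zariski[G [hG ->]] ZAB.
apply: contrapT => /not_orP[/existsNP[P /not_implyP[ZP /existsNP[f /not_implyP[Ff fP]]]]].
move=> /existsNP[Q /not_implyP[ZQ /existsNP[h /not_implyP[Gh hQ]]]].
have [c [g [t0 [t1 [cc pg g0 [Pc Qc] cZ]]]]] := Zc P Q ZP ZQ.
have [e fe] := hF f Ff; have [e' he] := hG h Gh.
have ft0 : f.@[flatten_coord (c t0)] != 0 by apply/eqP => /(pvanishE fe Pc).
have ht1 : h.@[flatten_coord (c t1)] != 0 by apply/eqP => /(pvanishE he Qc).
have pf := polyfun_curve f cc; have ph := polyfun_curve h cc.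
have [t ght] := polyfun_generic2 infK pg ph g0 (ex_intro _ t1 ht1).
have [t' [/= fst ght']] := polyfun_generic2 infK pf (polyfunM pg ph) (ex_intro _ t0 ft0)
  (ex_intro _ t (mulf_neq0 ght.1 ght.2)).
pose fgh t := f.@[flatten_coord (c t)] * (g t * h.@[flatten_coord (c t)]).
have [||s [/= fghs [R Rc]]] := curve_generic (g := fgh) cc _ _ Pc.
- by apply: polyfunM => //; exact: polyfunM.
- by exists t'; exact: mulf_neq0.
- move: fghs; rewrite /fgh !mulf_eq0 => /norP[/eqP fs /norP[gs /eqP hs]].
  case: (ZAB R (cZ s R gs Rc)) => [/(_ f Ff)|/(_ h Gh)].
    by move=> /(pvanishE fe Rc).
  by move=> /(pvanishE he Rc).
Qed.

End Curves.

Lemma irreducible_closure (T : topologicalType) (Z : set T) :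
  irreducible Z -> irreducible (closure Z).
Proof.
move=> [[P ZP] ZI]; split; first by exists P; exact: subset_closure.
move=> A B cA cB ZAB.
have [|ZA|ZB] := ZI A B cA cB; first exact: (subset_trans (@subset_closure _ Z)).
  by left; rewrite closureE; apply: smallest_sub.
by right; rewrite closureE; apply: smallest_sub.
Qed.

(** * Multilinear forms *)

Section MultilinearForms.
Local Open Scope ring_scope.
Variables (K : fieldType) (r : nat) (m : 'I_r -> nat).
Notation vecs := (forall j, 'rV[K]_(m j).+1).
Notation form := 'cV[K]_(segre_dim m).+1.

Definition mform (h : form) (x : vecs) : K := \sum_k segre_vec x 0 k * h k 0.

(** Forms being linear in each factor, [mform h (mix [set j] x w)] is the partial derivative of [h]
    at [x] in the direction [w j] of the factor [j]. *)
Definition mix (S : {set 'I_r}) (x w : vecs) : vecs :=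
  fun j => if j \in S then w j else x j.

Lemma mform_mulmx h x : mform h x = (segre_vec x *m h) 0 0.
Proof. by rewrite mxE. Qed.

Lemma eq_mform h x y : (forall j, x j = y j) -> mform h x = mform h y.
Proof. by move=> xy; congr (mform h _); apply: functional_extensionality_dep. Qed.

Lemma mform_scale h (c : 'I_r -> K) x :
  mform h (fun j => c j *: x j) = (\prod_j c j) * mform h x.
Proof.
rewrite mulr_sumr; apply: eq_bigr => k _; rewrite mulrA !mxE -big_split.
by congr (_ * _); apply: eq_bigr => j _; rewrite mxE.
Qed.

Lemma mform_mix_scale_eq0 h (c : 'I_r -> K) S x w : (forall j, c j != 0) ->
  (mform h (mix S (fun j => c j *: x j) w) == 0) = (mform h (mix S x w) == 0).
Proof.
move=> c0; pose c' j := if j \in S then 1 else c j.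
rewrite (@eq_mform h _ (fun j => c' j *: mix S x w j)); last first.
  by move=> j; rewrite /mix /c'; case: ifP; rewrite ?scale1r.
rewrite mform_scale mulf_eq0 (_ : (_ == 0) = false) //; apply: negbTE.
by apply/prodf_neq0 => j _; rewrite /c'; case: ifP => //; rewrite oner_neq0.
Qed.

Lemma mform_linear h z w j a b :
  mform h (fun i => if i == j then a *: z i + b *: w i else z i)
    = a * mform h z + b * mform h (mix [set j] z w).
Proof.
rewrite !mulr_sumr -big_split; apply: eq_bigr => k _ /=.
rewrite !mulrA -mulrDl; congr (_ * _); rewrite !mxE.
rewrite (bigD1 j) // [in X in _ = a * X + _](bigD1 j) //.
rewrite [in X in _ = _ + b * X](bigD1 j) //= /mix !inE !eqxx !mxE.
rewrite mulrDl !mulrA; congr (_ * _ + _ * _); apply: eq_bigr => i /negPf ij.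
  by rewrite ij.
by rewrite ij inE ij.
Qed.

Lemma mform_expand h (S : {set 'I_r}) x w t :
  mform h (fun j => if j \in S then x j + t *: w j else x j)
    = \sum_(B : {set 'I_r} | B \subset S) t ^+ #|B| * mform h (mix B x w).
Proof.
rewrite [RHS](eq_bigr (fun B : {set 'I_r} =>
  \sum_k t ^+ #|B| * (segre_vec (mix B x w) 0 k * h k 0))); last first.
  by move=> B _; rewrite mulr_sumr.
rewrite exchange_big; apply: eq_bigr => k _ /=.
under [RHS]eq_bigr do rewrite mulrA.
rewrite -mulr_suml; congr (_ * _); rewrite mxE.
pose F j := if j \in S then t * w j 0 (nth_multi_index k j) else 0.
rewrite (eq_bigr (fun j => F j + x j 0 (nth_multi_index k j))); last first.
  by move=> j _; rewrite /F; case: ifP => _; rewrite ?add0r // !mxE addrC.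
rewrite bigA_distr [in RHS]big_mkcond; apply: eq_bigr => B _ /=.
case: ifPn => [/fintype.subsetP BS|/subsetPn[j jB jS]]; last first.
  by rewrite (bigD1 j) //= jB /F (negPf jS) mul0r.
rewrite mxE -prodr_const [in RHS]big_mkcond -big_split; apply: eq_bigr => j _ /=.
by rewrite /F /mix; case: ifPn => [/[dup]/BS -> //|_]; rewrite mul1r.
Qed.

Lemma polyfun_mform (h : K -> form) (x : K -> vecs) :
  (forall k, polyfun (fun t => h t k 0)) ->
  (forall j a, polyfun (fun t => x t j 0 a)) ->
  polyfun (fun t => mform (h t) (x t)).
Proof.
move=> hp xp; apply: polyfun_sum => k _; apply: polyfunM => //.
by under eq_fun do rewrite mxE; apply: polyfun_prod => j _.
Qed.

Definition multi_idx (f : forall j, 'I_(m j).+1) : 'I_(segre_dim m).+1 :=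
  cast_ord (esym (card_multi_index m)) (enum_rank (finfun f : multi_index m)).

Lemma nth_multi_idx f j : nth_multi_index (multi_idx f) j = f j.
Proof. by rewrite /nth_multi_index cast_ordKV enum_rankK ffunE. Qed.

Definition basis_vecs (k : 'I_(segre_dim m).+1) : vecs :=
  fun j => delta_mx 0 (nth_multi_index k j).

Lemma basis_vecs_neq0 k j : basis_vecs k j != 0.
Proof.
by apply/rV0Pn; exists (nth_multi_index k j); rewrite mxE !eqxx oner_neq0.
Qed.

Lemma segre_vec_basis k : segre_vec (basis_vecs k) = delta_mx 0 k.
Proof.
apply/rowP => l; rewrite !mxE eqxx; case: (l =P k) => [->|lk].
  by rewrite big1 // => j _; rewrite mxE !eqxx.
have [j jP] : exists j, nth_multi_index l j != nth_multi_index k j.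
  apply: contrapT => /forallNP E; apply: lk; apply: (@cast_ord_inj _ _ (card_multi_index m)).
  by apply: enum_val_inj; apply/ffunP => j; apply/eqP/negPn/negP/E.
by rewrite (bigD1 j) //= mxE eqxx (negPf jP) mul0r.
Qed.

Lemma mform_basis h k : mform h (basis_vecs k) = h k 0.
Proof.
rewrite /mform segre_vec_basis (bigD1 k) //= mxE !eqxx mul1r big1 ?addr0 // => l lk.
by rewrite mxE (negPf lk) andbF mul0r.
Qed.

(* A point of a multilinear hypersurface moves inside it to a point where some partial
   derivative of the form is nonzero. *)
Lemma mform_smoothing h x w : mform h x = 0 -> mform h w != 0 ->
  exists j (S : {set 'I_r}), forall t, let y i := if i \in S then x i + t *: w i else x i in
    mform h y = 0 /\ (t != 0 -> mform h (mix [set j] y w) != 0).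
Proof.
move=> hx hw; have mixT : mform h (mix [set: 'I_r]%SET x w) != 0.
  by rewrite (@eq_mform h _ w) // => j; rewrite /mix inE.
(* [S] is a smallest set of factors whose replacement by those of [w] makes the form nonzero; it is
   nonempty because [h] vanishes at [x]. *)
case: (arg_minnP (P := fun S => mform h (mix S x w) != 0) (fun S : {set 'I_r} => #|S|) mixT).
move=> S hS Smin.
have S0 (B : {set 'I_r}) : B \proper S -> mform h (mix B x w) = 0.
  by move=> /proper_card BS; apply: contraTeq BS => /Smin; rewrite -leqNgt.
have [j jS] : exists j, j \in S.
  apply/set0Pn; apply: contraNneq hS => ->; rewrite -(@eq_mform h x) ?hx // => j.
  by rewrite /mix inE.
(* Moving in the factors of [S] other than [j] keeps the form zero: every term of the expansion
   belongs to a proper subset of [S]. *)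
exists j, (S :\ j)%SET => t /=; split=> [|t0].
  rewrite mform_expand big1 // => B BS; rewrite S0 ?mulr0 //.
  exact: sub_proper_trans BS (properD1 jS).
rewrite (@eq_mform h _ (fun i => if i \in (S :\ j)%SET
    then mix [set j] x w i + t *: w i else mix [set j] x w i)); last first.
  by move=> i; rewrite /mix !inE; case: eqP.
(* Only [B = S :\ j] survives, with the nonzero factor [mform h (mix S x w)]; for any other [B] the
   set [j |: B] is a proper subset of [S]. *)
rewrite mform_expand (bigD1 (S :\ j)%SET) //= big1 ?addr0 => [|B /andP[BS BneS]].
  rewrite mulf_neq0 ?expf_neq0 // (@eq_mform h _ (mix S x w)) // => i.
  by rewrite /mix !inE; case: eqP => [->|]; rewrite ?jS.
rewrite (@eq_mform h _ (mix (j |: B)%SET x w)) => [|i]; last first.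
  by rewrite /mix !inE; case: eqP => [->|] //=; case: ifP.
rewrite S0 ?mulr0 // finset.properEneq finset.subUset finset.sub1set jS.
rewrite (fintype.subset_trans BS (finset.subsetDl _ _)).
rewrite !andbT; apply: contraNneq BneS => <-; rewrite finset.setU1K //.
by apply: contraTN BS => jB; apply/fintype.subsetPn; exists j => //; rewrite !inE eqxx.
Qed.

End MultilinearForms.

(** * The locus of tuples lying on a hyperplane *)

Section HyperplaneLocus.
Local Open Scope ring_scope.
Local Open Scope classical_set_scope.
Variables (K : fieldType) (r : nat) (m : 'I_r -> nat) (n : nat).
Hypothesis infK : forall p : {poly K}, p != 0 -> exists t, p.[t] != 0.
Notation vecs := (forall j, 'rV[K]_(m j).+1).
Notation fam := (forall ij : 'I_n * 'I_r, 'rV[K]_(m ij.2).+1).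
Notation form := 'cV[K]_(segre_dim m).+1.
Notation space := (multiproj K (fun ij : 'I_n * 'I_r => m ij.2)).

Definition part (x : fam) (i : 'I_n) : vecs := fun j => x (i, j).

(** [A] selects the points on which the condition is imposed: all of them for [Seg], an initial
    segment for the other members of the chain. *)
Definition hyperplane_locus (A : pred 'I_n) : set space :=
  [set P | exists2 h : form, h != 0 & exists2 x : fam, represents P x
    & forall i, A i -> mform h (part x i) = 0].

(* [J i] is a set of factors in the direction of which h has a nonzero partial derivative at the
   i-th point. *)
Definition smooth_locus (A : pred 'I_n) (J : 'I_n -> {set 'I_r}) : set space :=
  [set P | exists (h : form) (x : fam) (w : 'I_n -> vecs), represents P x /\
    forall i, A i -> mform h (part x i) = 0 /\
      forall j, j \in J i -> mform h (mix [set j]%SET (part x i) (w i)) != 0].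

(** The derivative in the correcting factor [j i] is nonzero at both ends, so the corrected curve
    still joins [P] to [Q]. The derivatives in [J1], nonzero at [Q], stay nonzero for generic
    [t]. *)
Lemma smooth_locus_joined A (J0 J1 J : 'I_n -> {set 'I_r}) (j : 'I_n -> 'I_r) P Q :
  (forall i, j i \in J0 i) -> (forall i, j i \in J1 i) ->
  (forall i, J i \subset J1 i) ->
  smooth_locus A J0 P -> smooth_locus A J1 Q ->
  exists c (g : K -> K),
    [/\ curve c, polyfun g, exists t, g t != 0,
        represents P (c 0) /\ represents Q (c 1)
      & forall t R, g t != 0 -> represents R (c t) -> smooth_locus A J R].
Proof.
move=> jJ0 jJ1 JJ1 [h0 [x0 [w0 [Px0 hx0]]]] [h1 [x1 [w1 [Qx1 hx1]]]].
pose line (a b : K) t := a + t * (b - a).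
have line0 a b : line a b 0 = a by rewrite /line mul0r addr0.
have line1 a b : line a b 1 = b by rewrite /line mul1r addrC subrK.
have line_poly a b : polyfun (line a b).
  by apply: polyfunD; [exact: polyfun_cst|apply: polyfunM;
    [exact: polyfun_id|exact: polyfun_cst]].
pose h t : form := \col_k line (h0 k 0) (h1 k 0) t.
pose z t : fam := fun ij => \row_a line (x0 ij 0 a) (x1 ij 0 a) t.
pose w t i : vecs := fun j => \row_a line (w0 i j 0 a) (w1 i j 0 a) t.
have [h_0 h_1] : h 0 = h0 /\ h 1 = h1.
  by split; apply/colP => k; rewrite mxE ?line0 ?line1.
have z0 ij : z 0 ij = x0 ij by apply/rowP => a; rewrite mxE line0.
have z1 ij : z 1 ij = x1 ij by apply/rowP => a; rewrite mxE line1.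
have w_0 i j' : w 0 i j' = w0 i j' by apply/rowP => a; rewrite mxE line0.
have w_1 i j' : w 1 i j' = w1 i j' by apply/rowP => a; rewrite mxE line1.
have hp k : polyfun (fun t => h t k 0) by under eq_fun do rewrite mxE.
have zp ij a : polyfun (fun t => z t ij 0 a) by under eq_fun do rewrite mxE.
have wp i j' a : polyfun (fun t => w t i j' 0 a) by under eq_fun do rewrite mxE.
pose b t i := mform (h t) (mix [set j i]%SET (part (z t) i) (w t i)).
pose a t i := mform (h t) (part (z t) i).
(* The correction in the factor [j i] puts the i-th point back on the hypersurface. *)
pose c t : fam := fun ij => if A ij.1 && (ij.2 == j ij.1) then
  b t ij.1 *: z t ij - a t ij.1 *: w t ij.1 ij.2 else z t ij.
have mixp (S : {set 'I_r}) x i :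
    (forall j' l, polyfun (fun t => part (x t) i j' 0 l)) ->
    forall j' l, polyfun (fun t => mix S (part (x t) i) (w t i) j' 0 l).
  by move=> xp j' l; rewrite /mix; case: (j' \in S).
have bp i : polyfun (b ^~ i) by apply: polyfun_mform => //; apply: mixp => j' l; exact: zp.
have ap i : polyfun (a ^~ i) by apply: polyfun_mform => // j' l; exact: zp.
have combp k (f g : K -> K) (u v : K -> 'rV[K]_k) l : polyfun f -> polyfun g ->
    polyfun (fun t => u t 0 l) -> polyfun (fun t => v t 0 l) ->
    polyfun (fun t => (f t *: u t - g t *: v t) 0 l).
  move=> fp gp up vp; under eq_fun do rewrite !mxE.
  by apply: polyfunD; last apply: polyfunN; apply: polyfunM.
have cc : curve c.
  by move=> ij l; rewrite /c; case: (A _ && _) => //; apply: combp.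
(* By linearity in the factor [j i], the value is [b * a - a * b]. *)
have hc t i : A i -> mform (h t) (part (c t) i) = 0.
  move=> Ai; rewrite -[RHS](subrr (b t i * a t i)) [in X in _ - X]mulrC.
  rewrite -[X in X - _]/(b t i * mform (h t) (part (z t) i)) -mulNr.
  rewrite -mform_linear; apply: eq_mform => j'.
  by rewrite /part /c /= Ai /=; case: eqP; rewrite ?scaleNr.
pose g t := \prod_(i | A i) \prod_(j' in J1 i)
  mform (h t) (mix [set j']%SET (part (c t) i) (w t i)).
(* Where [a] vanishes and [b] does not, as at both ends, the correction merely rescales the
   vectors. *)
have rep_c t x (hz : forall i, A i -> mform (h t) (part (z t) i) = 0)
    (xz : forall ij, z t ij = x ij) (hb : forall i, A i -> b t i != 0) :
    exists2 e : 'I_n * 'I_r -> K, forall ij, e ij != 0 & forall ij, c t ij = e ij *: x ij.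
  exists (fun ij => if A ij.1 && (ij.2 == j ij.1) then b t ij.1 else 1) => ij.
    by case: ifP => [/andP[/hb]|_] //; rewrite oner_neq0.
  rewrite /c; case: ifP => [/andP[Ai _]|_]; last by rewrite scale1r xz.
  by rewrite /a hz // scale0r subr0 xz.
have [e0 e0_neq0 c0E] : exists2 e : 'I_n * 'I_r -> K,
    forall ij, e ij != 0 & forall ij, c 0 ij = e ij *: x0 ij.
  apply: rep_c => // i Ai; have [hxi hj] := hx0 i Ai.
    by rewrite h_0; apply: etrans hxi; apply: eq_mform => j'; exact: (z0 (i, j')).
  have := hj _ (jJ0 i); rewrite /b h_0; congr (_ != 0); apply: eq_mform => j'.
  by rewrite /mix w_0 /part z0.
have [e1 e1_neq0 c1E] : exists2 e : 'I_n * 'I_r -> K,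
    forall ij, e ij != 0 & forall ij, c 1 ij = e ij *: x1 ij.
  apply: rep_c => // i Ai; have [hxi hj] := hx1 i Ai.
    by rewrite h_1; apply: etrans hxi; apply: eq_mform => j'; exact: (z1 (i, j')).
  have := hj _ (jJ1 i); rewrite /b h_1; congr (_ != 0); apply: eq_mform => j'.
  by rewrite /mix w_1 /part z1.
exists c, g; split=> //.
- apply: polyfun_prod => i _; apply: polyfun_prod => j' _.
  by apply: polyfun_mform => //; apply: mixp => ? ?; exact: cc.
- exists 1; apply/prodf_neq0 => i Ai; apply/prodf_neq0 => j' j'J1.
  have := (hx1 i Ai).2 _ j'J1.
  rewrite -(mform_mix_scale_eq0 h1 _ _ _ (fun j => e1_neq0 (i, j))).
  rewrite h_1; congr (_ != 0); apply: eq_mform => j''.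
  by rewrite /mix w_1 /part c1E.
- by split=> ij; rewrite ?c0E ?c1E vline_scale.
- move=> t R /prodf_neq0 gt Rc; exists (h t), (c t), (w t); split=> // i Ai.
  split=> [|j' j'J]; first exact: hc.
  by move: (gt i Ai) => /prodf_neq0; apply; exact: (fintype.subsetP (JJ1 i)).
Qed.

Definition regular_locus A := smooth_locus A (fun=> [set: 'I_r]%SET).

(** All vectors are [e_0], and [h] is the sum of the Segre coordinates other than the one that is
    nonzero there; replacing a single factor by [e_1] gives the value 1. *)
Lemma regular_locus_neq0 A : (forall j, 0 < m j)%N -> regular_locus A !=set0.
Proof.
move=> m_gt0; pose k0 := @multi_idx r m (fun=> ord0).
pose h : form := \col_k (k != k0)%:R.
pose x : fam := fun ij => basis_vecs K k0 ij.2.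
pose w (i : 'I_n) : vecs := fun j => delta_mx 0 (inord 1).
have [|P Px] := @represents_exists K _ _ x.
  by move=> ij; exact: basis_vecs_neq0.
exists P, h, x, w; split=> // i _; split=> [|j _].
  by rewrite -[part x i]/(basis_vecs K k0) mform_basis mxE eqxx.
pose k1 := @multi_idx r m (fun j' => if j' == j then inord 1 else ord0).
have E j' : mix [set j]%SET (part x i) (w i) j' = basis_vecs K k1 j'.
  rewrite /mix /basis_vecs /x /w /part nth_multi_idx finset.in_set1.
  by case: eqP => // _; rewrite /basis_vecs nth_multi_idx.
rewrite (eq_mform h E) mform_basis mxE.
case: (k1 =P k0) => [k10|_]; last exact: oner_neq0.
have := congr1 (fun k => nth_multi_index k j : nat) k10.
by rewrite !nth_multi_idx eqxx inordK // ltnS.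
Qed.

Lemma irreducible_regular_locus A (j0 : 'I_r) : (forall j, 0 < m j)%N ->
  irreducible (regular_locus A).
Proof.
move=> m_gt0; apply: irreducible_curves => //; first exact: regular_locus_neq0.
move=> P Q PA QA; have [|||c [g [cc pg g0 PQ cA]]] :=
    smooth_locus_joined (j := fun=> j0) (J := fun=> [set: 'I_r]%SET) _ _ _ PA QA.
- by move=> i; rewrite inE.
- by move=> i; rewrite inE.
- by move=> i.
- by exists c, g, 0, 1.
Qed.

Lemma closure_regular_locus A (j : 'I_n -> 'I_r) : (forall j, 0 < m j)%N ->
  smooth_locus A (fun i => [set j i]%SET) `<=` closure (regular_locus A).
Proof.
move=> m_gt0 P PA; have [Q QA] := regular_locus_neq0 A m_gt0.
have [|||c [g [cc pg g0 [Pc Qc] cA]]] :=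
    smooth_locus_joined (j := j) (J := fun=> [set: 'I_r]%SET) _ _ _ PA QA.
- by move=> i; rewrite inE.
- by move=> i; rewrite inE.
- by move=> i.
- exact: (curve_closure infK cc pg g0 Pc cA).
Qed.

Lemma hyperplane_locus_closure A (j0 : 'I_r) : (forall j, 0 < m j)%N ->
  hyperplane_locus A `<=` closure (regular_locus A).
Proof.
move=> m_gt0 P [h h0 [x Px hx]].
have [k hk] : exists k, h k 0 != 0 by exact/cV0Pn.
have hw : mform h (basis_vecs K k) != 0 by rewrite mform_basis.
have /choice[jS jSP] i : exists jS : 'I_r * {set 'I_r}, A i ->
    forall t, let y j := if j \in jS.2 then part x i j + t *: basis_vecs K k j else part x i j in
    mform h y = 0 /\ (t != 0 -> mform h (mix [set jS.1]%SET y (basis_vecs K k)) != 0).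
  have [Ai|nAi] := boolP (A i).
    have [j [S jS]] := mform_smoothing (hx i Ai) hw.
    by exists (j, S) => _; exact: jS.
  by exists (j0, finset.set0).
pose c t : fam := fun ij => if A ij.1 && (ij.2 \in (jS ij.1).2)
  then x ij + t *: basis_vecs K k ij.2 else x ij.
have cc : curve c.
  move=> ij a; rewrite /c; case: (A _ && _); last exact: polyfun_cst.
  under eq_fun do rewrite !mxE.
  apply: polyfunD; first exact: polyfun_cst.
  by apply: polyfunM; [exact: polyfun_id|exact: polyfun_cst].
have Pc : represents P (c 0).
  by move=> ij; rewrite /c; case: ifP => _; rewrite ?scale0r ?addr0; exact: Px.
(* It is enough to approach [P] by tuples with one nonzero derivative at each point, these being
   limits of regular ones. *)
have sub : closure (smooth_locus A (fun i => [set (jS i).1]%SET)) `<=` closure (regular_locus A).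
  rewrite closureE; apply: smallest_sub; first exact: closed_closure.
  exact: closure_regular_locus.
apply: sub; apply: (curve_closure infK cc (polyfun_id K) _ Pc).
  by exists 1; rewrite oner_neq0.
move=> t R t0 Rc; exists h, (c t), (fun=> basis_vecs K k); split=> // i Ai.
have [hy smooth] := jSP i Ai t.
have cE j : part (c t) i j =
    if j \in (jS i).2 then part x i j + t *: basis_vecs K k j else part x i j.
  by rewrite /part /c /= Ai.
split=> [|j]; first by rewrite (eq_mform h cE).
rewrite inE => /eqP ->; have := smooth t0; congr (_ != 0); apply: eq_mform => j'.
by rewrite /mix cE.
Qed.

(** A nonzero derivative at the constrained point [i0] forces [h] to be nonzero. *)
Lemma regular_locus_sub (A : pred 'I_n) i0 (j0 : 'I_r) : A i0 ->
  regular_locus A `<=` hyperplane_locus A.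
Proof.
move=> Ai0 P [h [x [w [Px hx]]]]; exists h; last by exists x => // i /hx[].
have /(_ j0) := (hx i0 Ai0).2; rewrite inE => /(_ isT); apply: contra_neq => ->.
by rewrite /mform big1 // => k _; rewrite [X in _ * X]mxE mulr0.
Qed.

Lemma row_full_ker p q (B : 'M[K]_(p, q)) : ~~ row_full B ->
  exists2 h : 'cV[K]_q, h != 0 & B *m h = 0.
Proof.
rewrite -cokermx_eq0 => /eqP B0.
have [k kP] : exists k, col k (cokermx B) != 0.
  apply: contrapT => /forallNP Bk; apply: B0; apply/matrixP => i k; rewrite [RHS]mxE.
  have /negP := Bk k; rewrite negbK => /eqP/colP/(_ i); by rewrite !mxE.
by exists (col k (cokermx B)); rewrite // colE mulmxA mulmx_coker mul0mx.
Qed.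

Notation pol := {mpoly K[#|{: pvar (fun ij : 'I_n * 'I_r => m ij.2)}|]}.

(** The Leibniz expansion of the determinant whose rows are the Segre vectors of the points
    [g a]. *)
Definition minor (g : 'I_(segre_dim m).+1 -> 'I_n) : pol :=
  \sum_(s : 'S_(segre_dim m).+1) (-1) ^+ s *:
    \prod_a \prod_j 'X_(enum_rank (Tagged (fun ij : 'I_n * 'I_r => 'I_(m ij.2).+1)
      (i := (g a, j)) (nth_multi_index (s a) j))).

Lemma multihomog_minor g :
  multihomog (fun ij => \sum_a \sum_(j : 'I_r) ((g a, j) == ij))%N (minor g).
Proof.
apply: multihomog_sum => s _; apply: multihomogZ; apply: multihomog_prod => a.
by apply: multihomog_prod => j; apply: multihomogX.
Qed.

Lemma meval_minor g (x : fam) :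
  (minor g).@[flatten_coord x] = \det (\matrix_(a, b) segre_vec (part x (g a)) 0 b).
Proof.
rewrite /minor raddf_sum; apply: eq_bigr => s _; rewrite /= mevalZ; congr (_ * _).
rewrite rmorph_prod; apply: eq_bigr => a _; rewrite !mxE rmorph_prod.
by apply: eq_bigr => j _; rewrite /= meval_pvar.
Qed.

Lemma closed_hyperplane_locus A : closed (hyperplane_locus A).
Proof.
apply/closed_zariski.
exists [set f | exists2 g : 'I_(segre_dim m).+1 -> 'I_n, forall a, A (g a) & f = minor g]; split.
  move=> _ [g _ ->]; eexists; exact: multihomog_minor.
apply/seteqP; split=> P.
  move=> [h h0 [x Px hx]] _ [g Ag ->].
  apply/(pvanishE (@multihomog_minor g) Px); rewrite meval_minor; apply/eqP.
  rewrite -det_tr; apply/det0P; exists h^T; first by rewrite -trmx0 (inj_eq trmx_inj).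
  rewrite -trmx_mul -[RHS]trmx0; congr (_^T); apply/colP => a; rewrite mxE [RHS]mxE.
  by rewrite -[RHS](hx _ (Ag a)); apply: eq_bigr => b _; rewrite mxE.
move=> minorP; pose x : fam := fun ij => hcoord (P ij).
(* Rows outside [A] are set to zero, so that a nonzero maximal minor can only use indices in [A]. *)
pose B : 'M[K]_(n, _) := \matrix_i (if A i then segre_vec (part x i) else 0).
have [Bfull|Bfull] := boolP (row_full B); last first.
  have [h h0 Bh] := row_full_ker Bfull; exists h => //; exists x.
    exact: represents_hcoord.
  move=> i Ai; have := congr1 (fun M : 'cV_n => M i 0) Bh; rewrite [RHS]mxE => <-.
  by rewrite mform_mulmx !mxE; apply: eq_bigr => b _; rewrite [B i b]mxE Ai.
have := fullrowsub_unit Bfull; set g := fullrankfun Bfull; rewrite unitmxE unitfE.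
case: (pselect (forall a, A (g a))) => [Ag|/existsNP[a /negP Aga]]; last first.
  case/negP; rewrite (expand_det_row _ a) big1 // => b _.
  by rewrite !mxE (negPf Aga) !mxE mul0r.
case/negP; apply/eqP.
have {}minorP : pvanish (minor g) P by apply: minorP; exists g.
rewrite -[RHS]minorP /pvanish (meval_minor g x); congr (\det _).
by apply/matrixP => a b; rewrite !mxE Ag !mxE.
Qed.

(** A hyperplane gives a nonzero form annihilating a basis of it; conversely, the kernel of a
    nonzero form has codimension one because the image is a line. *)
Lemma on_hyperplaneE (P : space) :
  on_hyperplane [set segre (factor P i) | i in [set: 'I_n]] <-> hyperplane_locus predT P.
Proof.
pose x : fam := fun ij => hcoord (P ij).
have segreP i : val (segre (factor P i)) = <[segre_vec (part x i)]>%VS by [].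
split=> [[H dimH HP]|[h h0 [y Py hy]]].
  pose B := \matrix_(k < \dim H) (vbasis H)`_k.
  have [|h h0 Bh] := @row_full_ker _ _ B.
    by rewrite /row_full neq_ltn (leq_ltn_trans (rank_leq_row _)) // dimH.
  exists h => //; exists x => [|i _]; first exact: represents_hcoord.
  have : segre_vec (part x i) \in H by rewrite memvE -segreP; apply: HP; exists i.
  move=> /coord_vbasis xE; rewrite mform_mulmx xE mulmx_suml summxE big1 // => k _.
  have := congr1 (fun M : 'cV_(\dim H) => M k 0) Bh.
  rewrite -scalemxAl [RHS]mxE mxE => Bhk.
  rewrite -[RHS](mulr0 (coord (vbasis H) k (segre_vec (part x i)))) -Bhk.
  by rewrite mxE; congr (_ * _); rewrite mxE; apply: eq_bigr => b _; rewrite !mxE.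
pose f : 'Hom('rV[K]_(segre_dim m).+1, 'M[K]_1) := linfun (mulmxr h).
exists (lker f).
  have : (\dim (lker f) + \dim (limg f))%N = (segre_dim m).+1.
    by have := limg_ker_dim f fullv; rewrite capfv dimvf => ->; exact: mul1n.
  have : (\dim (limg f) <= 1)%N by rewrite (leq_trans (dimvS (subvf _))) // dimvf.
  case: (posnP (\dim (limg f))) => [/eqP|]; last first.
    by case: (\dim _) => [|[|]] // _ _; rewrite addn1 => -[].
  rewrite dimv_eq0 => /eqP f0; case/eqP: h0; apply/colP => k.
  have : f (delta_mx 0 k) \in limg f by apply: memv_img; exact: memvf.
  rewrite f0 memv0 lfunE /= => /eqP /matrixP/(_ 0 0).
  by rewrite -rowE !mxE.
move=> _ [i _ <-]; rewrite segreP -memvE memv_ker lfunE /=; apply/eqP/matrixP => a b.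
rewrite !ord1 -mform_mulmx mxE; have [c c0 xE] := represents_scale Py (represents_hcoord P).
rewrite (@eq_mform _ _ _ h _ (fun j => c (i, j) *: part y i j)) => [|j]; last exact: (xE (i, j)).
by rewrite mform_scale hy ?mulr0.
Qed.

Lemma Seg_hyperplane_locus : Seg K r m n = hyperplane_locus predT.
Proof.
rewrite /Seg (_ : [set P | _] = hyperplane_locus predT).
  by rewrite smallest_id //; exact: closed_hyperplane_locus.
by apply/seteqP; split=> P /on_hyperplaneE.
Qed.

End HyperplaneLocus.

(** * Algebraically independent functions and chains *)

Section Chart.
Local Open Scope ring_scope.
Local Open Scope classical_set_scope.
Variables (K : fieldType) (I : finType) (d : I -> nat).
Notation family := (forall i, 'rV[K]_(d i).+1).
Notation pol := {mpoly K[#|{: pvar d}|]}.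
Notation space := (multiproj K d).

(* Normalizing the sum of the coordinates, rather than one coordinate, to 1 keeps the standard
   basis points in the chart. *)
Definition coord_sum k (v : 'rV[K]_k) : K := \sum_a v 0 a.

Definition chart : set space := [set P | forall i, coord_sum (hcoord (P i)) != 0].

Definition chart_coord (P : space) : family :=
  fun i => (coord_sum (hcoord (P i)))^-1 *: hcoord (P i).

Lemma coord_sumZ k c (v : 'rV[K]_k) : coord_sum (c *: v) = c * coord_sum v.
Proof. by rewrite mulr_sumr; apply: eq_bigr => a _; rewrite mxE. Qed.

Lemma coord_sumB k (u v : 'rV[K]_k) : coord_sum (u - v) = coord_sum u - coord_sum v.
Proof. by rewrite -sumrB; apply: eq_bigr => a _; rewrite !mxE. Qed.

Lemma coord_sum_delta k (a : 'I_k) : coord_sum (delta_mx 0 a) = 1.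
Proof.
rewrite /coord_sum (bigD1 a) //= mxE !eqxx big1 ?addr0 // => b /negPf ba.
by rewrite mxE ba andbF.
Qed.

Lemma coord_sum_chart P i : chart P -> coord_sum (chart_coord P i) = 1.
Proof. by move=> cP; rewrite coord_sumZ mulVf. Qed.

Lemma represents_chart P : chart P -> represents P (chart_coord P).
Proof. by move=> cP i; rewrite vline_scale ?invr_neq0 // -hcoordE. Qed.

Lemma chart_coord_unique P (x : family) : represents P x ->
  (forall i, coord_sum (x i) = 1) -> chart P /\ forall i, chart_coord P i = x i.
Proof.
move=> Px x1; have [c c0 hE] := represents_scale Px (represents_hcoord P).
have cE i : coord_sum (hcoord (P i)) = c i by rewrite hE coord_sumZ x1 mulr1.
split=> i; first by rewrite cE.
by rewrite /chart_coord cE hE scalerA mulVf ?scale1r.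
Qed.

(** Having multidegree [e] and the value 1 at normalized coordinates, this product serves to
    equalize multidegrees before an addition. *)
Definition chart_poly (e : I -> nat) : pol :=
  \prod_i \prod_(k < e i) \sum_a 'X_(enum_rank (Tagged (fun i => 'I_(d i).+1) (i := i) a)).

Lemma multihomog_chart_poly e : multihomog e (chart_poly e).
Proof.
have h : multihomog (fun i' => \sum_i \sum_(k < e i) (i == i'))%N (chart_poly e).
  apply: multihomog_prod => i; apply: multihomog_prod => k.
  by apply: multihomog_sum => a _; apply: multihomogX.
apply: (eq_multihomog h) => i'; rewrite (bigD1 i') //=.
rewrite [X in (_ + X)%N]big1 ?addn0 => [|i /negPf ii'].
  by rewrite sum_nat_const eqxx card_ord muln1.
by rewrite ii' sum_nat_const muln0.
Qed.

Lemma meval_chart_poly e (x : family) :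
  (chart_poly e).@[flatten_coord x] = \prod_i coord_sum (x i) ^+ e i.
Proof.
rewrite rmorph_prod; apply: eq_bigr => i _; rewrite rmorph_prod /=.
rewrite (eq_bigr (fun=> coord_sum (x i))) ?prodr_const ?card_ord // => k _.
by rewrite raddf_sum; apply: eq_bigr => a _; rewrite /= meval_pvar.
Qed.

Lemma meval_chart_poly1 e P : chart P ->
  (chart_poly e).@[flatten_coord (chart_coord P)] = 1.
Proof.
by move=> cP; rewrite meval_chart_poly big1 // => i _; rewrite coord_sum_chart ?expr1n.
Qed.

Definition regular (g : space -> K) := exists e F, multihomog e F /\
  forall P, chart P -> g P = F.@[flatten_coord (chart_coord P)].

Lemma regular_cst c : regular (fun=> c).
Proof.
exists (fun=> 0%N), c%:MP; split; first exact: multihomogC.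
by move=> P _; rewrite mevalC.
Qed.

Lemma regularM f g : regular f -> regular g -> regular (fun P => f P * g P).
Proof.
move=> [e [F [Fe fF]]] [e' [G [Ge gG]]].
exists (fun i => e i + e' i)%N, (F * G); split; first exact: multihomogM.
by move=> P cP; rewrite mevalM fF ?gG.
Qed.

Lemma regularD f g : regular f -> regular g -> regular (fun P => f P + g P).
Proof.
move=> [e [F [Fe fF]]] [e' [G [Ge gG]]].
exists (fun i => e i + e' i)%N, (F * chart_poly e' + chart_poly e * G); split.
  apply: multihomogD; apply: multihomogM => //; exact: multihomog_chart_poly.
by move=> P cP; rewrite mevalD !mevalM !meval_chart_poly1 // mulr1 mul1r fF ?gG.
Qed.

Lemma regularX f k : regular f -> regular (fun P => f P ^+ k).
Proof.
move=> rf; elim: k => [|k IH]; first exact: regular_cst.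
by under eq_fun do rewrite exprS; exact: regularM.
Qed.

Lemma regular_sum (J : Type) (s : seq J) (F : J -> space -> K) :
  (forall j, regular (F j)) -> regular (fun P => \sum_(j <- s) F j P).
Proof.
move=> FP; elim: s => [|j s IH].
  by under eq_fun do rewrite big_nil; exact: regular_cst.
by under eq_fun do rewrite big_cons; exact: regularD.
Qed.

Lemma regular_prod (J : Type) (s : seq J) (F : J -> space -> K) :
  (forall j, regular (F j)) -> regular (fun P => \prod_(j <- s) F j P).
Proof.
move=> FP; elim: s => [|j s IH].
  by under eq_fun do rewrite big_nil; exact: regular_cst.
by under eq_fun do rewrite big_cons; exact: regularM.
Qed.

Lemma regular_meval e (Q : {mpoly K[e]}) (y : 'I_e -> space -> K) :
  (forall i, regular (y i)) -> regular (fun P => Q.@[y ^~ P]).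
Proof.
move=> yr; under eq_fun do rewrite mevalE.
apply: regular_sum => u; apply: regularM; first exact: regular_cst.
by apply: regular_prod => i; apply: regularX.
Qed.

Lemma closed_chartC : closed (~` chart).
Proof.
apply/closed_zariski; exists [set chart_poly (fun=> 1%N)]; split.
  by move=> _ ->; exists (fun=> 1%N); exact: multihomog_chart_poly.
apply/seteqP; split=> P.
  move=> /existsNP[i /negP]; rewrite negbK => /eqP hi _ ->.
  by rewrite /pvanish meval_chart_poly (bigD1 i) //= hi expr1 mul0r.
move=> /(_ _ erefl); rewrite /pvanish meval_chart_poly => /eqP/prodf_eq0[i _].
by rewrite expr1 => hi /(_ i); rewrite hi.
Qed.

Lemma closed_regular_zero f : regular f ->
  exists2 A, closed A & forall P, chart P -> A P <-> f P = 0.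
Proof.
move=> [e [F [Fe fF]]]; exists (zero_locus [set F]).
  by apply/closed_zariski; exists [set F]; split=> // _ ->; exists e.
move=> P cP; rewrite fF // -(pvanishE Fe (represents_chart cP)); split=> [|h _ ->] //.
by apply.
Qed.

(** Points outside the chart are absorbed by adding its closed complement to one of the two zero
    sets, which then cover [Z]. *)
Lemma irreducible_regular Z f g : irreducible Z -> regular f -> regular g ->
  (forall P, Z P -> chart P -> f P * g P = 0) ->
  (forall P, Z P -> chart P -> f P = 0) \/ (forall P, Z P -> chart P -> g P = 0).
Proof.
move=> [_ Zirr] /closed_regular_zero[A cA fA] /closed_regular_zero[B cB gB] fg.
have cAB : closed (A `|` ~` chart) by apply: closedU => //; exact: closed_chartC.
have [P ZP|ZA|ZB] := Zirr _ _ cAB cB; last first.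
- by right=> P ZP cP; apply/(gB P cP); exact: ZB.
- by left=> P ZP cP; apply/(fA P cP); case: (ZA P ZP).
have [cP|] := pselect (chart P); last by left; right.
have /eqP := fg P ZP cP; rewrite mulf_eq0 => /orP[]/eqP.
  by left; left; apply/fA.
by right; apply/gB.
Qed.

(** Algebraic independence of the restrictions to the part of [Z] in the chart; [Q = 1] shows that
    this part is nonempty. *)
Definition indep (Z : set space) e (y : 'I_e -> space -> K) :=
  forall Q : {mpoly K[e]}, (forall P, Z P -> chart P -> Q.@[y ^~ P] = 0) -> Q = 0.

Definition extend e (y : 'I_e -> space -> K) f : 'I_e.+1 -> space -> K :=
  fun i => if unlift ord_max i is Some j then y j else f.
Arguments extend : clear implicits.

Lemma meval_extend e (y : 'I_e -> space -> K) f (Q : {mpoly K[e.+1]}) P :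
  Q.@[(extend e y f) ^~ P] = (map_poly (meval (y ^~ P)) (muni Q)).[f P].
Proof.
rewrite meval_muni /extend unlift_none; congr (_.[_]).
apply: eq_map_poly => p; apply: meval_eq => i.
by rewrite widen_ord_lift liftK.
Qed.

Lemma indep_chart Z e (y : 'I_e -> space -> K) : indep Z y -> exists2 P, Z P & chart P.
Proof.
move=> yZ; apply: contrapT => noP; have /eqP : (1 : {mpoly K[e]}) = 0.
  by apply: yZ => P ZP cP; case: noP; exists P.
by rewrite oner_eq0.
Qed.

(* A relation Q(y, f) on Z', divided by the largest power of its last variable, still holds on
   Z' because f is not identically zero there; restricted to Z, where f = 0, it gives a
   nontrivial relation between the y. *)
Lemma indep_extend Z Z' e (y : 'I_e -> space -> K) :
  closed Z -> irreducible Z' -> Z `<=` Z' -> ~ Z' `<=` Z ->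
  (forall i, regular (y i)) -> indep Z y ->
  exists2 f, regular f & indep Z' (extend e y f).
Proof.
move=> cZ iZ' ZZ' Z'Z yr yZ.
have [P [Z'P ZP cP]] : exists P, [/\ Z' P, ~ Z P & chart P].
  apply: contrapT => noP; have [|Z'sub|Z'sub] := iZ'.2 Z (~` chart) cZ closed_chartC.
  - move=> P Z'P; have [ZP|nZP] := pselect (Z P); first by left.
    by right=> cP; apply: noP; exists P.
  - exact: Z'Z.
  - by have [R ZR cR] := indep_chart yZ; exact: Z'sub (ZZ' R ZR) cR.
have /closed_zariski[F [Fh ZE]] := cZ.
(* The new function comes from an equation of [Z] that does not vanish at [P]. *)
have [f0 [Ff0 f0P]] : exists f0, F f0 /\ ~ pvanish f0 P.
  apply: contrapT => noF; apply: ZP; rewrite ZE => f0 Ff0; apply: contrapT => f0P.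
  by apply: noF; exists f0.
have [e0 f0h] := Fh f0 Ff0.
pose f R := f0.@[flatten_coord (chart_coord R)].
have fr : regular f by exists e0, f0.
have fZ R : Z R -> chart R -> f R = 0.
  move=> ZR cR; apply/(pvanishE f0h (represents_chart cR)).
  by move: ZR; rewrite ZE; apply.
have fP : f P != 0 by apply/eqP => /(pvanishE f0h (represents_chart cP)).
exists f => // Q QZ'; apply: contrapT => /eqP Q0.
have [k [q]] := multiplicity_XsubC (muni Q) 0.
rewrite (raddf_eq0 _ (@muni_inj K e)) Q0 polyC0 subr0 /= => q0 QE.
pose g R := (map_poly (meval (y ^~ R)) q).[f R].
have gr : regular g.
  pose g' R := \sum_(i < size q) (q`_i).@[y ^~ R] * f R ^+ i.
  have -> : g = g'.
    apply: funext => R; rewrite /g (@horner_coef_wide _ (size q)) ?size_poly //.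
    by apply: eq_bigr => i _; rewrite coef_map.
  by apply: regular_sum => i; apply: regularM; [exact: regular_meval|exact: regularX].
have [R Z'R cR|gZ'|fk] := irreducible_regular iZ' gr (regularX k fr).
- have := QZ' R Z'R cR; rewrite meval_extend QE rmorphM rmorphXn /= map_polyX.
  by rewrite hornerM hornerXn.
(* As [f] is zero on [Z], the constant term of [q] is a relation between the [y], although [q] is
   not divisible by its variable. *)
- case/negP: q0; rewrite /root; apply/eqP; apply: yZ => R ZR cR.
  have := gZ' R (ZZ' R ZR) cR; rewrite /g fZ // !horner_coef0.
  by rewrite coef_map.
- by have /eqP := fk P Z'P cP; rewrite expf_eq0 (negPf fP) andbF.
Qed.

(** On the chart the zeroth coordinate of each factor is 1 minus the sum of the others, so regular
    functions are polynomials in the remaining coordinates. *)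
Lemma indep_le Z e (y : 'I_e -> space -> K) :
  (forall i, regular (y i)) -> indep Z y -> (e <= #|{: {i : I & 'I_(d i)}}|)%N.
Proof.
move=> /choice[E /choice[F FP]] yZ; rewrite leqNgt; apply/negP => lt_e.
set N := #|_| in lt_e.
pose var i (b : 'I_(d i)) : {mpoly K[N]} := 'X_(enum_rank (Tagged (fun i => 'I_(d i)) b)).
pose sub (k : 'I_#|{: pvar d}|) : {mpoly K[N]} :=
  if unlift ord0 (tagged (enum_val k)) is Some b then var _ b
  else 1 - \sum_b var (tag (enum_val k)) b.
pose aff P (k : 'I_N) := chart_coord P (tag (enum_val k)) 0 (lift ord0 (tagged (enum_val k))).
have varE P i b : (var i b).@[aff P] = chart_coord P i 0 (lift ord0 b).
  by rewrite /var mevalXU /aff enum_rankK.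
have subE P k : chart P -> (sub k).@[aff P] = flatten_coord (chart_coord P) k.
  move=> cP; rewrite /sub /flatten_coord; case: unliftP => [b ->|->]; first exact: varE.
  rewrite mevalB meval1 (raddf_sum (meval (aff P))) /=.
  under eq_bigr do rewrite varE.
  by rewrite -(coord_sum_chart (tag (enum_val k)) cP) /coord_sum big_ord_recl addrK.
pose G := [tuple F i \mPo [tuple sub k | k < _] | i < e].
have [Q Q0 QG] := mpoly_dependent G lt_e.
case/eqP: Q0; apply: yZ => P _ cP.
have := congr1 (meval (aff P)) QG; rewrite meval0 comp_mpoly_meval => <-.
apply: meval_eq => i; rewrite tnth_mktuple comp_mpoly_meval (FP i).2 //.
by apply: meval_eq => k; rewrite tnth_mktuple subE.
Qed.

(** The chain increases from [Z], and each step adjoins one more independent function. *)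
Lemma chain_length_le Z c F e (y : 'I_e -> space -> K) : irreducible_chain Z c F ->
  (forall i, regular (y i)) -> indep Z y -> (c + e <= #|{: {i : I & 'I_(d i)}}|)%N.
Proof.
move=> [F0 Firr Flt] yr yZ.
suff [y' yr' yF] : exists2 y' : 'I_(c + e) -> space -> K,
    forall i, regular (y' i) & indep (F c) y' by exact: indep_le yr' yF.
suff : forall i, (i <= c)%N -> exists2 y' : 'I_(i + e) -> space -> K,
    forall i, regular (y' i) & indep (F i) y' by exact.
elim=> [_|i IH ic]; first by exists y; rewrite ?F0.
have [y' yr' yF] := IH (ltnW ic).
have [f fr yF'] := indep_extend (Firr i (ltnW ic)).1 (Firr i.+1 ic).2
  (Flt i ic).1 (Flt i ic).2 yr' yF.
exists (extend _ y' f) => // j; rewrite /extend; case: unliftP => //.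
Qed.

End Chart.

(** * Independent coordinates and the codimension *)

Section IndependentCoordinates.
Local Open Scope ring_scope.
Local Open Scope classical_set_scope.
Variables (K : fieldType) (r : nat) (m : 'I_r -> nat) (n : nat) (j0 : 'I_r).
Hypothesis infK : forall p : {poly K}, p != 0 -> exists t, p.[t] != 0.
Hypothesis m_gt0 : forall j, (0 < m j)%N.
Hypothesis n_gt : (segre_dim m < n)%N.
Notation M := (segre_dim m).
Notation vecs := (forall j, 'rV[K]_(m j).+1).
Notation fam := (forall ij : 'I_n * 'I_r, 'rV[K]_(m ij.2).+1).
Notation form := 'cV[K]_(segre_dim m).+1.
Notation space := (multiproj K (fun ij : 'I_n * 'I_r => m ij.2)).

Notation avar := {ij : 'I_n * 'I_r & 'I_(m ij.2)}.

(* For a point of index at least M, the last coordinate of its factor j0 is determined by the other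
   coordinates. *)
Definition dependent (v : avar) : bool :=
  [&& (M <= (tag v).1)%N, (tag v).2 == j0 & (tagged v).+1 == m (tag v).2].

Definition free : {pred avar} := [pred v | ~~ dependent v].

(** A dependent variable is determined by the index of its point, which takes [n - M] values. *)
Lemma card_free : (#|{: avar}| <= #|free| + (n - M))%N.
Proof.
rewrite -(cardC free) leq_add2l.
have -> : (n - M = #|'I_(n - M).-1.+1|)%N by rewrite card_ord prednK // subn_gt0.
pose f (v : avar) : 'I_(n - M).-1.+1 := inord ((tag v).1 - M).
apply: (@leq_card_in _ _ f).
move=> [[i j] b] [[i' j'] b']; rewrite !inE !negbK => /and3P[/= Mi /eqP jj0 /eqP bm].
move=> /and3P[/= Mi' /eqP jj0' /eqP bm']; subst j j' => /(congr1 val) /=.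
rewrite !inordK ?prednK ?subn_gt0 ?ltn_sub2r // => ii'.
have {ii'} : i = i' by apply: val_inj; rewrite /= -(subnK Mi) ii' subnK.
move=> ii'; subst i'; congr existT; apply: val_inj; apply: succn_inj.
by rewrite /= bm bm'.
Qed.

Definition free_coord (k : 'I_#|free|) (P : space) : K :=
  chart_coord P (tag (enum_val k)) 0 (lift ord0 (tagged (enum_val k))).

Lemma regular_free_coord k : regular (free_coord k).
Proof.
have h := @multihomogX K _ _ (Tagged (fun ij : 'I_n * 'I_r => 'I_(m ij.2).+1)
  (lift ord0 (tagged (enum_val k)))).
eexists; eexists; split; first exact: h.
by move=> P _; rewrite meval_pvar.
Qed.

(** * Solving for the dependent coordinates *)

Section Parametrization.
Variable v : 'I_#|free| -> K.

(** At a dependent variable the sum is empty and the value is 0. *)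
Definition full (a : avar) : K := \sum_(k | enum_val k == a) v k.

Definition base_coord : fam := fun ij => \row_a
  if unlift ord0 a is Some b then full (Tagged (fun ij => 'I_(m ij.2)) b)
  else 1 - \sum_b full (Tagged (fun ij => 'I_(m ij.2)) (i := ij) b).

Definition base_rows (s : 'rV[K]_M.+1) : 'M[K]_M.+1 := \matrix_a
  if unlift ord_max a is Some b
  then segre_vec (part base_coord (widen_ord (ltnW n_gt) b)) else s.

(** The form vanishing at the first [M] points, given by the cofactors along the last row; these do
    not depend on that row, so 0 is a placeholder. *)
Definition base_form : form := \col_k cofactor (base_rows 0) ord_max k.

(** Adding a multiple of it preserves the sum of the coordinates and alters only the first and the
    last of them. *)
Definition shift : vecs := fun j => delta_mx 0 ord_max - delta_mx 0 ord0.

Definition slope (i : 'I_n) : K :=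
  mform base_form (mix [set j0]%SET (part base_coord i) shift).

(** The form is linear in the factor [j0], so one Newton step along [shift] reaches its zero set
    when the slope is nonzero. *)
Definition solution : fam := fun ij =>
  if (M <= ij.1)%N && (ij.2 == j0)
  then base_coord ij - (mform base_form (part base_coord ij.1) / slope ij.1) *: shift ij.2
  else base_coord ij.

Lemma full_enum_val k : full (enum_val k) = v k.
Proof.
rewrite /full (bigD1 k) //= big1 ?addr0 // => l /andP[/eqP/enum_val_inj -> ].
by rewrite eqxx.
Qed.

Lemma coord_sum_base ij : coord_sum (base_coord ij) = 1.
Proof.
rewrite /coord_sum big_ord_recl mxE unlift_none.
by under [X in _ + X]eq_bigr do rewrite mxE liftK; rewrite subrK.
Qed.

Lemma coord_sum_shift j : coord_sum (shift j) = 0.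
Proof. by rewrite coord_sumB !coord_sum_delta subrr. Qed.

Lemma coord_sum_solution ij : coord_sum (solution ij) = 1.
Proof.
rewrite /solution; case: ifP => _; last exact: coord_sum_base.
by rewrite coord_sumB coord_sumZ coord_sum_shift mulr0 subr0 coord_sum_base.
Qed.

Lemma mform_base_form x : mform base_form x = \det (base_rows (segre_vec x)).
Proof.
rewrite (expand_det_row _ ord_max); apply: eq_bigr => k _; rewrite [X in _ * X]mxE.
congr (_ * _); first by rewrite [RHS]mxE unlift_none.
congr (_ * \det _); apply/matrixP => a b; rewrite !mxE.
by rewrite liftK.
Qed.

Lemma mform_base_form0 (i : 'I_n) : (i < M)%N -> mform base_form (part base_coord i) = 0.
Proof.
move=> iM; rewrite mform_base_form.
apply: (determinant_alternate (neq_lift ord_max (Ordinal iM))) => b.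
rewrite !mxE unlift_none liftK; congr (segre_vec (part base_coord _) 0 b).
exact: val_inj.
Qed.

Lemma solution_locus P : (forall i : 'I_n, (M <= i)%N -> slope i != 0) ->
  represents P solution -> hyperplane_locus predT P.
Proof.
move=> s0 PS; exists base_form.
  have := s0 (Ordinal n_gt) (leqnn _); apply: contra_neq => h0.
  by rewrite /slope h0 /mform big1 // => k _; rewrite [X in _ * X]mxE mulr0.
exists solution => // i _; have [iM|Mi] := ltnP i M.
  rewrite -[RHS](mform_base_form0 iM); apply: eq_mform => j.
  by rewrite /part /solution leqNgt iM.
rewrite -[RHS](subrr (mform base_form (part base_coord i))).
rewrite -[X in _ - X](divfK (s0 i Mi)) -[X in X - _]mul1r -mulNr -mform_linear.
apply: eq_mform => j; rewrite /part /solution /= Mi /=; case: eqP => // ->.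
by rewrite scale1r scaleNr.
Qed.

Lemma free_coord_solution P k : represents P solution -> free_coord k P = v k.
Proof.
move=> PS; rewrite /free_coord (chart_coord_unique PS coord_sum_solution).2.
have kfree : ~~ dependent (enum_val k) by have := enum_valP k.
have baseE : base_coord (tag (enum_val k)) 0 (lift ord0 (tagged (enum_val k))) = v k.
  by rewrite mxE liftK -full_enum_val; congr full; case: (enum_val k).
rewrite /solution; case: ifP => // /andP[Mk jk].
rewrite mxE baseE [X in _ + X]mxE [X in _ - X]mxE.
rewrite (_ : shift _ _ _ = 0) ?mulr0 ?oppr0 ?addr0 //.
rewrite !mxE /= subr0 (_ : (_ == ord_max) = false) //.
apply: contraNF kfree => /eqP/(congr1 val) /= kE.
by rewrite /dependent Mk jk /=; apply/eqP.
Qed.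

End Parametrization.

Lemma polyfun_slope (v : K -> 'I_#|free| -> K) i : (forall k, polyfun (v ^~ k)) ->
  polyfun (fun t => slope (v t) i).
Proof.
move=> vp; have fp a : polyfun (fun t => full (v t) a) by apply: polyfun_sum => k _.
have bp ij a : polyfun (fun t => base_coord (v t) ij 0 a).
  under eq_fun do rewrite mxE; case: (unlift ord0 a) => [b|] //.
  apply: polyfunD; first exact: polyfun_cst.
  by apply: polyfunN; apply: polyfun_sum.
apply: polyfun_mform => [k|j a]; last first.
  by rewrite /mix; case: (j \in _); [exact: polyfun_cst|exact: bp].
under eq_fun do rewrite mxE; apply: polyfunM; first exact: polyfun_cst.
apply: polyfun_det => a b; under eq_fun do rewrite !mxE.
case: (unlift _ _) => [c|]; last by under eq_fun do rewrite mxE; exact: polyfun_cst.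
by under eq_fun do rewrite mxE; apply: polyfun_prod => j _; exact: bp.
Qed.

Lemma base_coord_eq v (x : fam) : (forall ij, coord_sum (x ij) = 1) ->
  (forall a : avar, full v a = x (tag a) 0 (lift ord0 (tagged a))) ->
  forall ij, base_coord v ij = x ij.
Proof.
move=> x1 vx ij; apply/rowP => a; rewrite mxE; case: unliftP => [b ->|->]; first exact: vx.
under eq_bigr do rewrite vx.
by rewrite -(x1 ij) /coord_sum big_ord_recl addrK.
Qed.

Lemma mform_mixB h (x u u' : vecs) :
  mform h (mix [set j0]%SET x (fun j => u j - u' j))
    = mform h (mix [set j0]%SET x u) - mform h (mix [set j0]%SET x u').
Proof.
rewrite -[X in X - _]mul1r -mulN1r.
rewrite (@eq_mform _ _ _ h (mix _ x u') (mix [set j0]%SET (mix [set j0]%SET x u) u')).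
  rewrite -mform_linear; apply: eq_mform => j; rewrite /mix finset.in_set1.
  by case: eqP => // _; rewrite scale1r scaleN1r.
by move=> j; rewrite /mix; case: ifP.
Qed.

(* At the witness the Segre images of the first M points are all the standard basis vectors but
   one, which is the positive part of the shift of every other point. *)
Lemma slope_witness : exists v, forall i : 'I_n, (M <= i)%N -> slope v i != 0.
Proof.
pose k0 := @multi_idx r m (fun=> ord0).
pose k1 := @multi_idx r m (fun j => if j == j0 then ord_max else ord0).
have k01 : k0 != k1.
  apply/eqP => /(congr1 (fun k => nth_multi_index k j0 : nat)).
  by rewrite !nth_multi_idx eqxx /= => m0; have := m_gt0 j0; rewrite -m0.
pose idx (i : 'I_n) : 'I_M.+1 := if insub (i : nat) is Some b then lift k1 b else k0.
pose x : fam := fun ij => basis_vecs K (idx ij.1) ij.2.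
pose v (k : 'I_#|free|) : K := x (tag (enum_val k)) 0 (lift ord0 (tagged (enum_val k))).
have idxM (i : 'I_n) : (M <= i)%N -> idx i = k0.
  by move=> Mi; rewrite /idx; case: insubP => // b; rewrite ltnNge Mi.
have vx (a : avar) : full v a = x (tag a) 0 (lift ord0 (tagged a)).
  have [afree|] := boolP (a \in free).
    by rewrite -(enum_rankK_in afree afree) full_enum_val.
  rewrite negbK => adep; rewrite /full big1 => [|k /eqP ka].
    case/and3P: adep => Ma _ _; rewrite /x /basis_vecs idxM // nth_multi_idx mxE.
    by [].
  by have := enum_valP k; rewrite ka unfold_in adep.
have x1 ij : coord_sum (x ij) = 1 by exact: coord_sum_delta.
have xE := base_coord_eq x1 vx.
exists v => i Mi; rewrite /slope.
have h0 k : base_form v k 0 = \det (base_rows v (delta_mx 0 k)).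
  by rewrite -mform_basis mform_base_form segre_vec_basis.
have rowE b : segre_vec (part (base_coord v) (widen_ord (ltnW n_gt) b)) = delta_mx 0 (lift k1 b).
  rewrite -segre_vec_basis; congr segre_vec; apply: functional_extensionality_dep => j.
  rewrite /part xE /x /idx /=; case: insubP => [c _ cb|]; last by rewrite ltn_ord.
  by have -> : c = b by exact: val_inj.
(* The basis vector of index [k0] already occurs among the first [M] rows. *)
have hk0 : base_form v k0 0 = 0.
  have [b k0b|k0k1] := unliftP k1 k0; last by rewrite k0k1 eqxx in k01.
  rewrite h0; apply: (determinant_alternate (neq_lift ord_max b)) => c.
  by rewrite !mxE unlift_none liftK rowE k0b.
(* With the basis vector of index [k1] as last row, the matrix is a permutation matrix. *)
have hk1 : base_form v k1 0 != 0.
  rewrite h0 (_ : base_rows v _ = perm_mx (lift_perm ord_max k1 1)).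
    by rewrite det_perm signr_eq0.
  apply/matrixP => a c; rewrite mxE [RHS]mxE [RHS]mxE.
  case: unliftP => [b ->|->]; last by rewrite lift_perm_id mxE eqxx eq_sym.
  by rewrite lift_perm_lift perm1 rowE mxE eqxx eq_sym.
have mixE k (c : forall j, 'I_(m j).+1) :
    (forall j, nth_multi_index k j = if j == j0 then c j else ord0) ->
    mform (base_form v) (mix [set j0]%SET (part (base_coord v) i) (fun j => delta_mx 0 (c j)))
      = base_form v k 0.
  move=> kc; rewrite -mform_basis; apply: eq_mform => j; rewrite /mix finset.in_set1.
  rewrite /basis_vecs kc; case: eqP => // _.
  by rewrite /part xE /x /= idxM // /basis_vecs nth_multi_idx.
rewrite mform_mixB (mixE k1) ?(mixE k0) ?hk0 ?subr0 // => j; rewrite nth_multi_idx //.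
by case: eqP.
Qed.

(** On the line from a point where [Q] is nonzero to the witness for the slopes, some [v] makes [Q]
    and all slopes nonzero; the solution for [v] lies in the locus and has free coordinates [v]. *)
Lemma indep_free_coord : indep (@hyperplane_locus K r m n predT) free_coord.
Proof.
move=> Q QS; apply/eqP; apply: contraT => Q0.
have [v0 Qv0] := mpoly_neq0_meval infK Q0; have [v1 sv1] := slope_witness.
pose v t k := v0 k + t * (v1 k - v0 k).
have vp k : polyfun (v ^~ k).
  apply: polyfunD; first exact: polyfun_cst.
  by apply: polyfunM; [exact: polyfun_id|exact: polyfun_cst].
have v_0 : v 0 = v0 by apply: funext => k; rewrite /v mul0r addr0.
have v_1 : v 1 = v1 by apply: funext => k; rewrite /v mul1r addrC subrK.
pose g (o : option {i : 'I_n | (M <= i)%N}) t :=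
  if o is Some i then slope (v t) (val i) else Q.@[v t].
have [[i|]|[i|]|t gt] := polyfun_generic infK (g := g).
- exact: polyfun_slope.
- exact: polyfun_meval.
- by exists 1; rewrite /g v_1; apply: sv1; exact: valP i.
- by exists 0; rewrite /g v_0.
have [|P PS] := @represents_exists K _ _ (solution (v t)).
  move=> ij; apply/eqP => s0; have := coord_sum_solution (v t) ij.
  rewrite s0 /coord_sum big1 => [/eqP|a _]; last by rewrite mxE.
  by rewrite eq_sym oner_eq0.
have /eqP := gt None; case; rewrite /= -[RHS](QS P).
- by apply: meval_eq => k; rewrite (free_coord_solution k PS).
- apply: (solution_locus _ PS) => i Mi; exact: (gt (Some (exist _ i Mi))).
- exact: (chart_coord_unique PS (coord_sum_solution (v t))).1.
Qed.

End IndependentCoordinates.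

(** The integers below [size p] are distinct and too many to be all roots of [p]. *)
Lemma numDomain_poly_neq0 (K : numDomainType) (p : {poly K}) :
  (p != 0 -> exists t, p.[t] != 0)%R.
Proof.
move=> p0; apply: contrapT => /forallNP pt.
have /(max_poly_roots p0) : all (root p) [seq (i%:R)%R | i <- iota 0 (size p)].
  by apply/allP => _ /mapP[i _ ->]; have /negP := pt i%:R%R; rewrite negbK.
rewrite map_inj_uniq ?iota_uniq ?size_map ?size_iota ?ltnn => [/(_ isT)//|].
by move=> i k /eqP; rewrite Num.Theory.eqr_nat => /eqP.
Qed.

(** * The chain of loci and the codimension *)

Section Codimension.
Local Open Scope ring_scope.
Local Open Scope classical_set_scope.
Variables (K : numFieldType) (r : nat) (m : 'I_r -> nat) (n : nat) (j0 : 'I_r).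
Hypothesis m_gt0 : forall j, (0 < m j)%N.
Hypothesis n_gt : (segre_dim m < n)%N.
Notation M := (segre_dim m).
Let infK := @numDomain_poly_neq0 K.

Let first_on_hyperplane (q : nat) := @hyperplane_locus K r m n (fun i => (i < q)%N).

Lemma segre_dim_gt0 : (0 < M)%N.
Proof.
rewrite /segre_dim -ltnS prednK ?prodn_gt0 // (bigD1 j0) //=.
by rewrite (leq_trans _ (leq_pmulr _ _)) ?prodn_gt0 // ltnS.
Qed.

Lemma irreducible_first_on_hyperplane q : (0 < q)%N -> irreducible (first_on_hyperplane q).
Proof.
move=> q_gt0; have n_gt0 : (0 < n)%N by exact: leq_ltn_trans n_gt.
rewrite (_ : first_on_hyperplane q = closure (@regular_locus K r m n (fun i => (i < q)%N))).
  exact/irreducible_closure/irreducible_regular_locus.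
apply/seteqP; split; first exact: hyperplane_locus_closure.
rewrite closureE; apply: smallest_sub; first exact: closed_hyperplane_locus.
exact: (@regular_locus_sub K r m n (fun i => (i < q)%N) (Ordinal n_gt0) j0).
Qed.

Lemma first_on_hyperplane_lt q : (M <= q < n)%N ->
  first_on_hyperplane q.+1 `<` first_on_hyperplane q.
Proof.
move=> /andP[Mq qn]; split.
  by move=> P [h h0 [x Px hx]]; exists h => //; exists x => // i iq; apply/hx/ltnW.
(* The first [M] points go to [e_0, ..., e_(M-1)], the point [q] to [e_M], the others to [e_0]: the
   first [q] points lie where the last coordinate is zero, while the first [q + 1] span the whole
   space. *)
pose idx (i : 'I_n) : 'I_M.+1 := if i == q :> nat then ord_max else
  if (i < M)%N then inord i else ord0.
pose x (ij : 'I_n * 'I_r) : 'rV[K]_(m ij.2).+1 := basis_vecs K (idx ij.1) ij.2.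
have [|P Px] := @represents_exists K _ _ x.
  by move=> ij; exact: basis_vecs_neq0.
move=> /(_ P) []; first exists (delta_mx ord_max 0).
- by apply/cV0Pn; exists ord_max; rewrite mxE !eqxx oner_neq0.
- exists x => // i iq; rewrite -[part x i]/(basis_vecs K (idx i)) mform_basis mxE.
  rewrite andbT (_ : (_ == _) = false) // /idx ltn_eqF //.
  apply/negbTE; case: ifP => iM; rewrite -val_eqE /= ?inordK ?ltn_eqF ?segre_dim_gt0 //.
  exact: ltnW.
move=> h h0 [y Py hy]; case/eqP: h0; apply/colP => k; rewrite [RHS]mxE.
have [c c0 xE] := represents_scale Py Px.
have xh (i : 'I_n) : (i < q.+1)%N -> mform h (basis_vecs K (idx i)) = 0.
  move=> iq; rewrite -[basis_vecs K _]/(part x i).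
  rewrite (@eq_mform _ _ _ h _ (fun j => c (i, j) *: part y i j)) => [|j].
    by rewrite mform_scale hy ?mulr0.
  exact: (xE (i, j)).
have [kM|kM] := ltnP k M.
  rewrite -mform_basis -[RHS](xh (Ordinal (ltn_trans kM (leq_ltn_trans Mq qn)))) /=; last first.
    exact: ltn_trans kM _.
  rewrite /idx /= kM ltn_eqF ?(leq_trans kM) //; congr mform; congr basis_vecs.
  by apply: val_inj; rewrite /= inordK // ltnW.
rewrite -mform_basis -[RHS](xh (Ordinal qn)) //; congr mform; congr basis_vecs.
by rewrite /idx eqxx; apply: val_inj; apply/eqP; rewrite /= eqn_leq kM -ltnS ltn_ord.
Qed.

Lemma has_codim_first_on_hyperplane : has_codim (first_on_hyperplane n) (n - M).
Proof.
have irr i : (i <= n - M)%N -> closed (first_on_hyperplane (n - i)) /\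
    irreducible (first_on_hyperplane (n - i)).
  move=> iM; split; first exact: closed_hyperplane_locus.
  apply: irreducible_first_on_hyperplane; rewrite (leq_trans segre_dim_gt0) //.
  by rewrite -(subKn (ltnW n_gt)) leq_sub2l.
split.
  exists (fun i => first_on_hyperplane (n - i)); split; rewrite ?subn0 //.
  move=> i iM; rewrite -(@subnSK i n); last exact: leq_trans iM (leq_subr _ _).
  apply: first_on_hyperplane_lt; rewrite -(subKn (ltnW n_gt)) leq_sub2l //=.
  by rewrite ltn_subrL /= (leq_ltn_trans _ n_gt).
move=> k F Fk.
(* The length of the chain plus the number of free variables is at most the number of all variables,
   of which at most [n - M] are dependent. *)
have /(chain_length_le Fk (@regular_free_coord K r m n j0)) :
    indep (first_on_hyperplane n) (@free_coord K r m n j0).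
  rewrite (_ : first_on_hyperplane n = hyperplane_locus predT).
    exact: indep_free_coord.
  by congr hyperplane_locus; apply: funext => i; rewrite /= ltn_ord.
by move=> /leq_trans/(_ (card_free j0 n_gt)); rewrite addnC leq_add2l.
Qed.

End Codimension.

Theorem theorem2p3 (R : realType) (r : nat) (m : 'I_r -> nat) (n : nat)
    (r_ge1 : 1 <= r) (m_ge1 : forall j, 1 <= m j)
    (n_gt : segre_dim m < n) :
  [/\ closed (Seg R[i]%C r m n),
      irreducible (Seg R[i]%C r m n)
    & has_codim (Seg R[i]%C r m n) (n - segre_dim m)].
Proof.
have n_gt0 : 0 < n by exact: leq_ltn_trans n_gt.
have -> : Seg R[i]%C r m n = @hyperplane_locus R[i]%C r m n (fun i => i < n).
  rewrite Seg_hyperplane_locus; congr hyperplane_locus.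
  by apply: funext => i; rewrite /= ltn_ord.
split; first exact: closed_hyperplane_locus.
  exact: (irreducible_first_on_hyperplane _ (Ordinal r_ge1)).
exact: (has_codim_first_on_hyperplane _ (Ordinal r_ge1)).
Qed.
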